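(* Let $n\ge1$, let $T\in M_n'$ (the CAR $*$-algebra spanned by $n$ fermions) and let $t>0$. 1. $$\tau_n\Big(\int_t^\infty dF(s)\Big)\le2\exp\Big(-\frac{4t^2}{\pi^2\Vert\,|\nabla_sT|\,\Vert_{C_\infty}^2}\Big),$$ where $dF$ denotes the spectral measure of $|T-\tau_n(T)\mathrm{Id}|$. 2. Let $0<\alpha<\frac12$ and $K_\alpha=\frac1{\Gamma(1-\alpha)}\int_0^{\pi/2}(-\log\cos\theta)^{-\alpha}d\theta$. Then $$\tau_n\Big(\int_t^\infty dG_\alpha(s)\Big)\le2\exp\Big(-\frac{t^2}{2K_\alpha^2\Vert\,|\nabla_sT|\,\Vert_{C_\infty}^2}\Big),$$ where $dG_\alpha$ denotes the spectral measure of $|N'^\alpha T|$.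
   Context: $\mathcal{M}_{2^n}=\mathcal{M}_2\otimes\cdots\otimes\mathcal{M}_2$ is the algebra of complex $2^n\times2^n$ matrices with normalized trace $\tau_n$; $|S|=(S^*S)^{1/2}$; $\Vert\cdot\Vert_{C_\infty}$ is the operator norm. For a positive semidefinite matrix $X$ with spectral measure $dF$, $\int_t^\infty dF(s)$ is the spectral projection of $X$ for $[t,\infty)$, so its $\tau_n$ is $2^{-n}$ times the number of eigenvalues of $X$ (with multiplicity) that are $\ge t$. Let $U=\begin{pmatrix}1&0\\0&-1\end{pmatrix}$, $Q=\begin{pmatrix}0&1\\1&0\end{pmatrix}$ and $Q_j'=U\otimes\cdots\otimes U\otimes Q\otimes \mathrm{Id}\otimes\cdots\otimes\mathrm{Id}$ ($U$ in the first $j-1$ factors, $Q$ in the $j$-th). For $A=\{i_1<\cdots<i_k\}\subset\{1,\dots,n\}$ let $Q_A'=Q_{i_1}'\cdots Q_{i_k}'$, $Q_\emptyset'=\mathrm{Id}$. $M_n'$ is the $*$-algebra spanned by $Q_1',\dots,Q_n'$; the $Q_A'$ form a linear basis of it. On $M_n'$ define linearly $D_j'(Q_A')=Q_j'Q_A'$ if $j\in A$ and $0$ otherwise; $N'^\alpha(Q_A')=|A|^\alpha Q_A'$ for $A\ne\emptyset$, $N'^\alpha(\mathrm{Id})=0$. $|\nabla_sT|=\big(\sum_{j=1}^n|D_j'(T)^*|^2+|D_j'(T)|^2\big)^{1/2}$, with $|S|^2=S^*S$. When $\nabla_sT=0$ the right-hand sides are read as $0$. *)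

(* Defs.v *)
From HB Require Import structures.
From mathcomp Require Import all_boot all_order all_algebra.
From mathcomp Require Import sesquilinear spectral.
From mathcomp Require Import complex mxtens.
From mathcomp Require Import all_classical all_reals all_analysis.

Set Implicit Arguments.
Unset Strict Implicit.
Unset Printing Implicit Defensive.

Import Order.TTheory GRing.Theory Num.Theory.

Local Open Scope classical_set_scope.
Local Open Scope ring_scope.
Local Open Scope complex_scope.
Local Open Scope sesquilinear_scope.

(* Functional calculus for normal matrices; spectralmx and spectral_diag carry
   no information when A is not normal. *)
Definition mxcalc (R : realType) m (f : R[i] -> R[i]) (A : 'M[R[i]]_m) :
    'M[R[i]]_m :=
  invmx (spectralmx A) *m diag_mx (map_mx f (spectral_diag A)) *m spectralmx A.

Definition mxsqrt (R : realType) m (A : 'M[R[i]]_m) : 'M[R[i]]_m :=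
  mxcalc sqrtC A.

Definition mxsqmod (R : realType) m (S : 'M[R[i]]_m) : 'M[R[i]]_m :=
  S ^t* *m S.

Definition mxabs (R : realType) m (S : 'M[R[i]]_m) : 'M[R[i]]_m :=
  mxsqrt (mxsqmod S).

(* The projection-valued spectral measure of a Hermitian matrix A. *)
Definition spectral_measure (R : realType) m (A : 'M[R[i]]_m) (B : set R) :
    'M[R[i]]_m :=
  mxcalc (fun z => (\1_B (complex.Re z))%:C) A.

Definition l2norm (R : realType) m (x : 'cV[R[i]]_m) : R :=
  Num.sqrt (\sum_i ComplexField.Normc.normc (x i 0) ^+ 2).

Definition opnorm (R : realType) m (A : 'M[R[i]]_m) : R :=
  sup [set l2norm (A *m x) | x in [set x | l2norm x = 1]].

Definition ntrace (R : realType) n (A : 'M[R[i]]_(2 ^ n)) : R[i] :=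
  \tr A / (2 ^ n)%:R.

(* A 0 (x) A 1 (x) ... (x) A (n - 1); as for ntensmx, the recursion is on n - 1
   so that no cast is needed. *)
Fixpoint tensprod_rec (R : realType) (A : nat -> 'M[R[i]]_2) k :
    'M[R[i]]_(2 ^ k.+1) :=
  if k is k'.+1 then A 0%N *t tensprod_rec (fun i => A i.+1) k' else A 0%N.

Definition tensprod (R : realType) (A : nat -> 'M[R[i]]_2) n :
    'M[R[i]]_(2 ^ n) :=
  if n is k.+1 return 'M[R[i]]_(2 ^ n) then tensprod_rec A k else 1.

Definition pauliU (R : realType) : 'M[R[i]]_2 :=
  \matrix_(i, j) (if i == j then (-1) ^+ i else 0).

Definition pauliQ (R : realType) : 'M[R[i]]_2 :=
  \matrix_(i, j) (i != j)%:R.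

Definition fermion (R : realType) n (j : 'I_n) : 'M[R[i]]_(2 ^ n) :=
  tensprod (fun k => if (k < j)%N then pauliU R
                     else if k == j then pauliQ R else 1%:M) n.

Definition fermion_set (R : realType) n (A : {set 'I_n}) : 'M[R[i]]_(2 ^ n) :=
  \big[mulmx/1%:M]_(i < n | i \in A) fermion R i.

Definition star_subalgebra (R : realType) m (S : set 'M[R[i]]_m) : Prop :=
  [/\ S 1%:M,
      forall (a : R[i]) x y, S x -> S y -> S (a *: x + y),
      forall x y, S x -> S y -> S (x *m y)
    & forall x, S x -> S (x ^t*)].

Definition CAR (R : realType) n : set 'M[R[i]]_(2 ^ n) :=
  smallest (@star_subalgebra R (2 ^ n)) (range (@fermion R n)).
Arguments CAR : clear implicits.

Definition fermion_basis (R : realType) n :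
    #|{set 'I_n}|.-tuple 'M[R[i]]_(2 ^ n) :=
  [tuple fermion_set R (enum_val i) | i < #|{set 'I_n}|].

(* The linear map with values F A on the basis vectors fermion_set R A; it is
   only meaningful on their span, CAR R n. *)
Definition CAR_linear (R : realType) n (F : {set 'I_n} -> 'M[R[i]]_(2 ^ n))
    (T : 'M[R[i]]_(2 ^ n)) : 'M[R[i]]_(2 ^ n) :=
  \sum_(A : {set 'I_n}) coord (fermion_basis R n) (enum_rank A) T *: F A.

Definition CAR_D (R : realType) n (j : 'I_n) :
    'M[R[i]]_(2 ^ n) -> 'M[R[i]]_(2 ^ n) :=
  CAR_linear (fun A =>
    if j \in A then fermion R j *m fermion_set R A else 0).

Definition CAR_Npow (R : realType) n (alpha : R) :
    'M[R[i]]_(2 ^ n) -> 'M[R[i]]_(2 ^ n) :=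
  CAR_linear (fun A : {set 'I_n} =>
    if A == finset.set0 then 0 else (#|A|%:R `^ alpha)%:C *: fermion_set R A).

Definition CAR_grad (R : realType) n (T : 'M[R[i]]_(2 ^ n)) :
    {ffun 'I_n -> 'M[R[i]]_(2 ^ n)} :=
  [ffun j => CAR_D j T].

Definition CAR_absgrad (R : realType) n (T : 'M[R[i]]_(2 ^ n)) :
    'M[R[i]]_(2 ^ n) :=
  mxsqrt (\sum_j (mxsqmod ((CAR_grad T j) ^t*) + mxsqmod (CAR_grad T j))).

Definition Gamma (R : realType) (a : R) : R :=
  \int[lebesgue_measure]_(x in `]0, +oo[) (x `^ (a - 1) * expR (- x)).

Definition Kconst (R : realType) (alpha : R) : R :=
  (Gamma (1 - alpha))^-1 *
  \int[lebesgue_measure]_(theta in `]0, pi / 2[)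
     ((- ln (cos theta)) `^ (- alpha)).

(* Main.v *)
Require Import Defs.
From HB Require Import structures.
From mathcomp Require Import all_boot all_order all_algebra.
From mathcomp Require Import sesquilinear spectral.
From mathcomp Require Import complex mxtens polyrcf.
From mathcomp Require Import all_classical all_reals all_analysis.
From mathcomp Require Import measurable_realfun.
From mathcomp Require Import ring.

Set Implicit Arguments.
Unset Strict Implicit.
Unset Printing Implicit Defensive.

Import Order.TTheory GRing.Theory Num.Theory.

Local Open Scope ring_scope.
Local Open Scope sesquilinear_scope.

(** The theorem is a Gaussian tail bound, and it follows from Gaussian bounds on
even moments.  If [tau |X|^(2k) <= (2k-1)!! v^k] for every [k], Markov's
inequality gives [t^(2k) p <= (2k-1)!! v^k] for the tail mass [p]; summing these
with the Taylor weights of cosh gives [p * cosh (2u) <= exp u] where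
[u = t^2 / (2v)], whence [p <= 2 exp (- u)] ([subgaussian_tail]).  Write [G] for
the squared operator norm of the gradient.  The task is to bound the moments of
[X = T - tau T] with [v = G], and those of [X = N^alpha T] with
[v = K_alpha^2 G].  For [X = T - tau T] this gives [2 exp (- t^2 / (2 G))], which
is at least as good as the stated bound because [pi^2 >= 8].

The moments are controlled by rotating the fermions into an independent copy.
Let [q_1, ..., q_n, q'_1, ..., q'_n] be [2n] anticommuting symmetries, and let
[e] be a partial isometry anticommuting with all of them and such that [e^2 = 0],
[e e^* + e^* e = 1].  Then [hat X = e X + X^* e^*] is Hermitian, and the traces of
its even powers are, up to a constant, those of the powers of [|X|^2]
([mxtr_hat_emb]), so that non-selfadjoint [T] cost nothing.  For [c^2 + s^2 = 1]
there is a unitary [V] with [V^* q_j V = c q_j + s q'_j] ([rotation]).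
The derivation sending each [q_j] to [q'_j] maps [T = sum_A c_A q_A] to [sum_j
q'_j D_j T]; call [S] the hat of this matrix.  There are also unitaries [g_j]
which commute with [e] and with all the fermions except [q'_j], with which they
anticommute.  If [Z] commutes with all the [g_j], the monomials containing some
[q'_j] contribute nothing to the trace below, and therefore ([mxtr_rotated])
<<
   tr (S * V Z V^* ) = - s F'(c),   F(x) = sum_A x^|A| tr (hat (c_A q_A) Z).
>>
Everything rests on estimating the left-hand side.

_Centered part._  Take [Z = H^(2k+1)] with [H = hat (T - tau T)] and
[Y = V H V^*].  Conjugating [Y] by [g_j] changes it by a multiple of [s], so
[(Y, g_j Y g_j^* )] is an exchangeable pair in the sense of Stein's method, and a
Young inequality for traces ([mxtr_young], [mxtr_stein]) gives
[|F'(x)| <= (2k+1) G tr H^(2k)] on [0 < x < 1].  With the coefficients of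
[T - tau T], which has no constant term, [F 0 = 0] and [F 1 = tr H^(2k+2)];
the mean value theorem yields the recursion
[tr H^(2k+2) <= (2k+1) G tr H^(2k)] ([stein_step]), and the factors [2k+1]
multiply to the double factorial.

_Fractional part._  Take [Z = H^(2p-1)] with [H = hat (N^alpha T)].  The same Young
inequality bounds [K_alpha s |F'(c)|] by
[a K_alpha^(2p) tr S^(2p) + b tr H^(2p)] with weights [a + b = 1]
([moment_rotation]), while the exchangeable pair argument applied to [S] itself
bounds [tr S^(2p)] by the Gaussian moments ([grad_moment]).  To recover
[tr H^(2p) = sum_A |A|^alpha tr (hat (c_A q_A) Z)] from [F'], substitute
[u = - k log (cos theta)] in the integral defining [Gamma (1 - alpha)]:
<<
   k^alpha Gamma (1 - alpha)
     = int_0^(pi/2) (- log (cos theta))^(- alpha) k (cos theta)^(k-1) sin theta dtheta.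
>>
Integrating the bound on [s |F'(c)|] at [c = cos theta] and [s = sin theta]
against [(- log (cos theta))^(- alpha)] thus costs exactly a factor [K_alpha]
([fractional_transfer]), and absorbing the [tr H^(2p)] on the right gives
[tr H^(2p) <= K_alpha^(2p) tr S^(2p)].

Finally, a vanishing gradient means that [T] is scalar: [sum_j Q_j D_j T] equals
[sum_A |A| c_A Q_A], and the [Q_A] are orthogonal for the trace ([grad_eq0]). *)

(** * The adjoint and a trace inequality of Young type *)

Section Adjoint.
Variable C : numClosedFieldType.

Lemma adjmxM m n p (A : 'M[C]_(m, n)) (B : 'M[C]_(n, p)) :
  (A *m B)^t* = B^t* *m A^t*.
Proof. by rewrite trmx_mul map_mxM. Qed.

Lemma adjM n (A B : 'M[C]_n) : (A * B)^t* = B^t* * A^t*.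
Proof. exact: adjmxM. Qed.

Lemma adjmxD m n (A B : 'M[C]_(m, n)) : (A + B)^t* = A^t* + B^t*.
Proof. by rewrite linearD /= map_mxD. Qed.

Lemma adjmxN m n (A : 'M[C]_(m, n)) : (- A)^t* = - A^t*.
Proof. by rewrite linearN /= map_mxN. Qed.

Lemma adjmxZ m n a (A : 'M[C]_(m, n)) : (a *: A)^t* = a^* *: A^t*.
Proof. by rewrite linearZ /= map_mxZ. Qed.

Lemma adjmx_sum m n (I : Type) (r : seq I) (P : pred I) (F : I -> 'M[C]_(m, n)) :
  (\sum_(i <- r | P i) F i)^t* = \sum_(i <- r | P i) (F i)^t*.
Proof. by rewrite linear_sum /= map_mx_sum. Qed.

Lemma adjmx1 n : (1%:M : 'M[C]_n)^t* = 1%:M.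
Proof. by rewrite trmx1 map_mx1. Qed.

Lemma adjmxX n (A : 'M[C]_n) k : (A ^+ k)^t* = (A^t*) ^+ k.
Proof.
elim: k => [|k IHk]; first exact: adjmx1.
by rewrite exprSr adjmxM exprS IHk.
Qed.

Lemma adjmx_prod n (I : Type) (r : seq I) (F : I -> 'M[C]_n) :
  (\prod_(i <- r) F i)^t* = \prod_(i <- rev r) (F i)^t*.
Proof.
elim: r => [|i r IHr]; first by rewrite !big_nil adjmx1.
by rewrite big_cons rev_cons -cats1 big_cat big_seq1 adjmxM IHr.
Qed.

Lemma mxtr_adj n (A : 'M[C]_n) : \tr (A^t*) = (\tr A)^*.
Proof.
rewrite -map_trmx mxtrace_tr /mxtrace rmorph_sum.
by apply: eq_bigr => i _; rewrite mxE.
Qed.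

Lemma mxtr_sqmod m n (A : 'M[C]_(m, n)) :
  \tr (A^t* *m A) = \sum_i \sum_j `|A j i| ^+ 2.
Proof.
apply: eq_bigr => i _; rewrite mxE; apply: eq_bigr => j _.
by rewrite !mxE normCK mulrC.
Qed.

Lemma mxtr_sqmod_ge0 m n (A : 'M[C]_(m, n)) : 0 <= \tr (A^t* *m A).
Proof. by rewrite mxtr_sqmod; do 2![apply: sumr_ge0 => ? _]; rewrite exprn_ge0. Qed.

Lemma mxtrC n (A B : 'M[C]_n) : \tr (A * B) = \tr (B * A).
Proof. exact: mxtrace_mulC. Qed.

Lemma mxtr_conj n (U A : 'M[C]_n) : U^t* * U = 1 -> \tr (U * A * U^t*) = \tr A.
Proof. by move=> UU; rewrite mxtrC mulrA UU mul1r. Qed.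

Lemma exprX_conj n (U A : 'M[C]_n) k : U^t* * U = 1 -> U * U^t* = 1 ->
  (U * A * U^t*) ^+ k = U * A ^+ k * U^t*.
Proof.
move=> UU UU'; elim: k => [|k IHk]; first by rewrite !expr0 mulr1 UU'.
by rewrite exprS IHk exprS !mulrA -[U * A * _ * U]mulrA UU mulr1.
Qed.

End Adjoint.

Section TraceYoung.
Variable C : numClosedFieldType.

Lemma hermitian_spectral n (A : 'M[C]_n) (U := spectralmx A) (d := spectral_diag A) :
  A^t* = A -> [/\ U^t* * U = 1, U * U^t* = 1, forall i, d 0 i \is Num.real
    & A = U^t* * diag_mx d * U].
Proof.
move=> Aherm; have hA : A \is hermsymmx.
  by apply/is_hermitianmxP; rewrite scale1r /= Aherm.
have uU := spectral_unitarymx A.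
have UU : U * U^t* = 1 by apply/unitarymxP.
split=> //; first exact: mulmx1C.
  by move=> i; apply: (mxOverP (hermitian_spectral_diag_real hA)).
by rewrite /U -invmx_unitary //; apply/orthomx_spectralP/hermitian_normalmx.
Qed.

Lemma hermitian_decomp n (A : 'M[C]_n) : A^t* = A ->
  exists2 Ud : 'M[C]_n * 'rV[C]_n,
    [/\ Ud.1^t* * Ud.1 = 1, Ud.1 * Ud.1^t* = 1 & forall i, Ud.2 0 i \is Num.real]
    & A = Ud.1^t* * diag_mx Ud.2 * Ud.1.
Proof.
by move=> /hermitian_spectral[UU UU' dR AE]; exists (spectralmx A, spectral_diag A).
Qed.

Lemma diag_mxX n (d : 'rV[C]_n) k :
  diag_mx d ^+ k = diag_mx (map_mx (fun z => z ^+ k) d).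
Proof.
elim: k => [|k IHk].
  by rewrite expr0; apply/matrixP => i j; rewrite !mxE eq_sym; case: eqP => //=;
    rewrite ?mulr1n.
rewrite exprS IHk [_ * _]mulmx_diag; congr diag_mx.
by apply/rowP => i; rewrite !mxE exprS.
Qed.

Lemma mxtr_diag_mul4 n (d d' : 'rV[C]_n) (A B : 'M[C]_n) :
  \tr (A *m diag_mx d *m B *m diag_mx d') =
  \sum_i \sum_j d 0 j * d' 0 i * (A i j * B j i).
Proof.
apply: eq_bigr => i _; rewrite mxE (bigD1 i) //= big1 ?addr0; last first.
  by move=> j jNi; rewrite [diag_mx _ _ _]mxE (negbTE jNi) mulr0n mulr0.
rewrite [diag_mx _ _ _]mxE eqxx mulr1n mxE mulr_suml; apply: eq_bigr => j _.
rewrite mxE (bigD1 j) //= big1 ?addr0; last first.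
  by move=> k kNj; rewrite [diag_mx _ _ _]mxE (negbTE kNj) mulr0n mulr0.
by rewrite [diag_mx _ _ _]mxE eqxx mulr1n; ring.
Qed.

Lemma mxtr_diag_sqmod n (d : 'rV[C]_n) (A : 'M[C]_n) :
  \tr (A *m diag_mx d *m A^t*) = \sum_i \sum_j d 0 j * `|A i j| ^+ 2.
Proof.
rewrite -[_ *m _^t*]mulmx1 -[1%:M]diag_const_mx mxtr_diag_mul4.
by apply: eq_bigr => i _; apply: eq_bigr => j _; rewrite !mxE mulr1 normCK.
Qed.

Lemma expr_even_real (y : C) k : ~~ odd k -> y \is Num.real -> y ^+ k = `|y| ^+ k.
Proof.
move=> k_even yR; rewrite -[k]odd_double_half (negbTE k_even) add0n -mul2n !exprM.
by rewrite real_normK.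
Qed.

(** Diagonalize [Y] and [Z] in their own eigenbases.  The trace becomes a double
sum of [y_j^k z_i^l P_ij Q_ji], where [P] and [Q] are [A] and [B] written between
the two bases; the scalar Young inequality bounds [|y_j|^k |z_i|^l] and
[2 |P_ij Q_ji| <= |P_ij|^2 + |Q_ji|^2] separates [A] from [B].  Parity of [k + l]
allows the absolute values of the eigenvalues to be dropped when the sums are
folded back into traces. *)
Lemma mxtr_young n (Y Z A B : 'M[C]_n) k l (a b : C) :
  Y^t* = Y -> Z^t* = Z -> A^t* = A -> B^t* = B -> 0 <= a -> 0 <= b ->
  ~~ odd (k + l) ->
  (forall y z : C, 0 <= y -> 0 <= z ->
     y ^+ k * z ^+ l <= a * y ^+ (k + l) + b * z ^+ (k + l)) ->
  2 * `|\tr (A * Y ^+ k * B * Z ^+ l)|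
    <= a * (\tr (A * Y ^+ (k + l) * A) + \tr (B * Y ^+ (k + l) * B))
     + b * (\tr (A * Z ^+ (k + l) * A) + \tr (B * Z ^+ (k + l) * B)).
Proof.
move=> /hermitian_decomp[[U y] [/= UU UU' yR] ->].
move=> /hermitian_decomp[[V z] [/= VV VV' zR] ->] hA hB a0 b0 kl_even young.
have XU (d : 'rV[C]_n) W j : W^t* * W = 1 -> W * W^t* = 1 ->
    (W^t* * diag_mx d * W) ^+ j = W^t* * diag_mx (map_mx (fun z => z ^+ j) d) * W.
  move=> WW WW'; have := @exprX_conj C n (W^t*) (diag_mx d) j.
  by rewrite !trmxCK diag_mxX; apply.
rewrite !XU //; set N := (k + l)%N in kl_even *.
pose P := V * A * U^t*; pose Q := U * B * V^t*.
have hP : P^t* = U * A * V^t* by rewrite /P !adjM trmxCK hA mulrA.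
have hQ : Q^t* = V * B * U^t* by rewrite /Q !adjM trmxCK hB mulrA.
(* Each of the four traces on the right is a weighted Hilbert-Schmidt norm of [P]
   or [Q], after a change of basis on one side. *)
have trN (M W : 'M[C]_n) (d : 'rV[C]_n) W' :
    W'^t* * W' = 1 -> M^t* = M ->
    \tr (M * (W^t* * diag_mx d * W) * M) = \sum_i \sum_j d 0 j * `|(W' * M * W^t*) i j| ^+
      2.
  move=> WW hM; rewrite -mxtr_diag_sqmod !adjM trmxCK hM.
  rewrite -(@mxtr_conj _ _ W') //; congr (\tr _).
  by rewrite !mulmxE !mulrA.
rewrite (trN A U _ V) // (trN B U _ V) // (trN A V _ U) // (trN B V _ U) //.
rewrite -/P -/Q -hP -hQ.
have -> : \tr (A * (U^t* * diag_mx (map_mx (fun z => z ^+ k) y) * U) * B *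
             (V^t* * diag_mx (map_mx (fun z => z ^+ l) z) * V)) =
   \sum_i \sum_j y 0 j ^+ k * z 0 i ^+ l * (P i j * Q j i).
  rewrite -(@mxtr_conj _ _ V) //.
  transitivity (\tr (P *m diag_mx (map_mx (fun z => z ^+ k) y) *m Q *m
       diag_mx (map_mx (fun z => z ^+ l) z))).
    by rewrite /P /Q !mulmxE !mulrA -(mulrA _ V) VV' mulr1.
  rewrite mxtr_diag_mul4; do 2![apply: eq_bigr => ? _]; by rewrite !mxE.
have swap (F : 'I_n -> 'I_n -> C) (M : 'M[C]_n):
    \sum_i \sum_j F i j * `|M^t* i j| ^+ 2 = \sum_i \sum_j F j i * `|M i j| ^+ 2.
  rewrite exchange_big /=; apply: eq_bigr => i _; apply: eq_bigr => j _.
  by rewrite !mxE norm_conjC.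
rewrite [X in a * (_ + X)](swap (fun i j => map_mx (fun z0 : C => z0 ^+ N) y 0 j)).
rewrite [X in b * (X + _)](swap (fun i j => map_mx (fun z0 : C => z0 ^+ N) z 0 j)).
have XE (d : 'rV[C]_n) j : (forall i, d 0 i \is Num.real) ->
    map_mx (fun z0 : C => z0 ^+ N) d 0 j = `|d 0 j| ^+ N.
  by move=> dR; rewrite mxE expr_even_real.
clearbody P Q.
rewrite -subr_ge0.
have -> : a *
  (\sum_i \sum_j map_mx (fun z0 : C => z0 ^+ N) y 0 j * `|P i j| ^+ 2 +
   \sum_i \sum_j map_mx (fun z0 : C => z0 ^+ N) y 0 i * `|Q i j| ^+ 2) +
  b *
  (\sum_i \sum_j map_mx (fun z0 : C => z0 ^+ N) z 0 i * `|P i j| ^+ 2 +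
   \sum_i \sum_j map_mx (fun z0 : C => z0 ^+ N) z 0 j * `|Q i j| ^+ 2) =
  \sum_i \sum_j (a * `|y 0 j| ^+ N + b * `|z 0 i| ^+ N) * (`|P i j| ^+ 2 + `|Q j i| ^+ 2).
  rewrite [X in a * (_ + X)]exchange_big [X in b * (_ + X)]exchange_big /=.
  rewrite !mulrDr !mulr_sumr -!big_split /=; apply: eq_bigr => i _.
  rewrite !mulr_sumr -!big_split /=; apply: eq_bigr => j _.
  by rewrite !XE //; ring.
rewrite subr_ge0 -[2]ger0_norm // -normrM mulr_sumr.
apply: le_trans (ler_norm_sum _ _ _) _; apply: ler_sum => i _.
rewrite mulr_sumr; apply: le_trans (ler_norm_sum _ _ _) _; apply: ler_sum => j _.
rewrite !normrM !normrX ger0_norm // mulrCA.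
apply: ler_pM; rewrite ?mulr_ge0 ?exprn_ge0 //; first exact: young.
rewrite -subr_ge0.
have -> : `|P i j| ^+ 2 + `|Q j i| ^+ 2 - 2 * (`|P i j| * `|Q j i|) =
  (`|P i j| - `|Q j i|) ^+ 2 by ring.
by rewrite real_exprn_even_ge0 // realB // normr_real.
Qed.

End TraceYoung.

(** * Exchangeable pairs and Stein's estimate for traces *)

Section Stein.
Variable C : numClosedFieldType.

(** The arithmetic-geometric mean inequality for [k] copies of [y^(k+l)] and [l]
copies of [z^(k+l)].  That the weights sum to 1 is what keeps the moment
inequalities below free of constants. *)
Lemma young_weights k l : exists ab : C * C,
  [/\ 0 <= ab.1, 0 <= ab.2, ab.1 + ab.2 = 1, (0 < k)%N -> 0 < ab.1
    & forall y z : C, 0 <= y -> 0 <= z ->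
        y ^+ k * z ^+ l <= ab.1 * y ^+ (k + l) + ab.2 * z ^+ (k + l)].
Proof.
have [kl0|kl_gt0] := posnP (k + l).
  move/eqP: kl0; rewrite addn_eq0 => /andP[/eqP -> /eqP ->].
  by exists (1, 0); split => //=; rewrite ?addr0 // => y z _ _;
    rewrite !expr0 mulr1 mul0r addr0.
pose n : C := (k + l)%:R.
have n_gt0 : 0 < n by rewrite ltr0n.
exists (k%:R / n, l%:R / n); split => /=.
- by rewrite divr_ge0 ?ler0n.
- by rewrite divr_ge0 ?ler0n.
- by rewrite -mulrDl -natrD divff ?gt_eqF.
- by move=> k0; rewrite divr_gt0 ?ltr0n.
move=> y z y0 z0.
pose E (i : 'I_(k + l)) := if (i < k)%N then y ^+ (k + l) else z ^+ (k + l).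
have E0 : {in 'I_(k + l), forall i, 0 <= E i}.
  by move=> i _; rewrite /E; case: ifP => _; rewrite exprn_ge0.
have := (leif_AGM E0).1; rewrite card_ord !big_split_ord /=.
have El (i : 'I_k) : E (lshift l i) = y ^+ (k + l) by rewrite /E /= ltn_ord.
have Er (i : 'I_l) : E (rshift k i) = z ^+ (k + l).
  by rewrite /E /= ltnNge leq_addr.
under eq_bigr do rewrite El; under [X in _ * X]eq_bigr do rewrite Er.
under [X in X + _]eq_bigr do rewrite El; under [X in _ + X]eq_bigr do rewrite Er.
rewrite !prodr_const !sumr_const !card_ord (exprAC y) (exprAC z).
rewrite -exprMn ler_pXn2r ?nnegrE //; first by
  rewrite -(mulr_natl _ k) -(mulr_natl _ l) -/n => /le_trans; apply; rewrite le_eqVlt;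
    apply/orP; left; apply/eqP; ring.
- by rewrite mulr_ge0 ?exprn_ge0.
- by rewrite divr_ge0 ?ler0n // addr_ge0 ?mulrn_wge0 ?exprn_ge0.
Qed.

Lemma subXX_noncomm (R : pzRingType) (x y : R) n :
  x ^+ n - y ^+ n = \sum_(k < n) x ^+ k * (x - y) * y ^+ (n.-1 - k).
Proof.
elim: n => [|n IHn]; first by rewrite big_ord0 !expr0 subrr.
rewrite big_ord_recr /= subnn expr0 mulr1 mulrBr -exprSr.
have -> : \sum_(i < n) x ^+ i * (x - y) * y ^+ (n - i) = (x ^+ n - y ^+ n) * y.
  rewrite IHn mulr_suml; apply: eq_bigr => i _; rewrite -!mulrA -exprSr.
  by case: n i {IHn} => [[]|n] // i; rewrite subSn // -ltnS.
by rewrite mulrBl -[y ^+ n * y]exprSr [RHS]addrC addrA subrK.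
Qed.

(** Stein's method for the exchangeable pair [(Y, Z)], [Z = g Y g^*].  Since [A]
changes sign under [g], [2 tr (A Y^(N+1)) = tr (A (Y^(N+1) - Z^(N+1)))]; the
difference of powers telescopes into [N + 1] terms [A Y^k (Y - Z) Z^(N-k)], in
which [Y - Z] is a multiple of [B].  The trace Young inequality applies to each
term, and replacing [Z] by [Y] in its result is free because [A] and [B] only
change sign under [g]. *)
Lemma mxtr_stein m (Y A B g : 'M[C]_m) (kappa : C) N :
  Y^t* = Y -> A^t* = A -> B^t* = B ->
  g * g^t* = 1 -> g^t* * g = 1 ->
  Y - g * Y * g^t* = (2 * kappa) *: B ->
  g * A = - (A * g) -> g * B = - (B * g) -> ~~ odd N ->
  2 * `|\tr (A * Y ^+ N.+1)|
    <= `|kappa| * N.+1%:R * (\tr (A * Y ^+ N * A) + \tr (B * Y ^+ N * B)).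
Proof.
move=> hY hA hB gg' g'g YZ gA gB N_even.
set Z := g * Y * g^t* in YZ.
have hZ : Z^t* = Z by rewrite /Z !adjM trmxCK hY mulrA.
have ZX k : Z ^+ k = g * Y ^+ k * g^t* by rewrite exprX_conj.
have inv (X : 'M[C]_m) k : g * X = - (X * g) ->
    \tr (X * Z ^+ k * X) = \tr (X * Y ^+ k * X).
  move=> gX; have Xg : X * g = - (g * X) by rewrite gX opprK.
  have gX' : g^t* * X = - (X * g^t*).
    by rewrite -[LHS]mulr1 -gg' !mulrA -[g^t* * X * g]mulrA Xg mulrN mulrA g'g mul1r mulNr.
  rewrite ZX -(mxtr_conj (X * Y ^+ k * X) g'g); congr (\tr _).
  by rewrite !mulrA Xg !mulNr -!mulrA gX' !mulrN opprK !mulrA.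
have anti : 2 * \tr (A * Y ^+ N.+1) = \tr (A * (Y ^+ N.+1 - Z ^+ N.+1)).
  have -> : \tr (A * (Y ^+ N.+1 - Z ^+ N.+1)) = \tr (A * Y ^+ N.+1) - \tr (A * Z ^+ N.+1).
    by rewrite mulrBr linearB.
  have Ag : A * g = - (g * A) by rewrite gA opprK.
  rewrite ZX !mulrA Ag !mulNr -[g * A * _]mulrA linearN /= opprK mxtr_conj //.
  by ring.
rewrite -[2]ger0_norm // -normrM anti subXX_noncomm YZ mulr_sumr raddf_sum /=.
apply: le_trans (ler_norm_sum _ _ _) _.
have -> : `|kappa| * N.+1%:R * (\tr (A * Y ^+ N * A) + \tr (B * Y ^+ N * B)) =
   \sum_(k < N.+1) `|kappa| * (\tr (A * Y ^+ N * A) + \tr (B * Y ^+ N * B)).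
  by rewrite sumr_const card_ord -[RHS]mulr_natr mulrAC.
apply: ler_sum => k _; have [[a b]] /= := young_weights k (N - k).
case=> a0 b0 ab1 _ young.
have kN : (k + (N - k) = N)%N by rewrite subnKC // -ltnS.
have := @mxtr_young C m Y Z A B k (N - k) a b hY hZ hA hB a0 b0.
rewrite kN in young *; move=> /(_ N_even young).
rewrite !inv // -mulrDl ab1 mul1r => le2.
rewrite -!mulmxE -!scalemxAr -!scalemxAl -scalemxAr !mulmxA !mulmxE linearZ /= normrM.
rewrite normrM ger0_norm // [2 * `|_|]mulrC -[X in X <= _]mulrA.
exact: ler_wpM2l.
Qed.

End Stein.

(** * Monomials in a family of matrices and their partial derivatives *)

Section Monomials.
Variables (C : numClosedFieldType) (m n : nat).
Local Notation M := 'M[C]_m.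
Implicit Types (y z : 'I_n -> M) (A : {set 'I_n}) (s : seq 'I_n) (c : {set 'I_n} -> C).

Lemma mxscaleMl (a : C) (x y : M) : (a *: x) * y = a *: (x * y).
Proof. by rewrite -!mulmxE scalemxAl. Qed.

Lemma mxscaleMr (a : C) (x y : M) : x * (a *: y) = a *: (x * y).
Proof. by rewrite -!mulmxE scalemxAr. Qed.

Definition wordmx y s : M := \prod_(i <- s) y i.

Definition monomx y A : M := \prod_(i in A) y i.

Definition lincomb y c : M := \sum_A c A *: monomx y A.

Definition partialD y c j : M := \sum_(A : {set 'I_n} | j \in A) c A *: (y j * monomx y A).

(** The order in which the product defining [monomx y A] is taken. *)
Definition ordmem A := [seq i <- index_enum 'I_n | i \in A].

Lemma ordmem_uniq A : uniq (ordmem A).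
Proof. by rewrite filter_uniq // index_enum_uniq. Qed.

Lemma mem_ordmem A : ordmem A =i A.
Proof. by move=> i; rewrite mem_filter mem_index_enum andbT. Qed.

Lemma monomx_word y A : monomx y A = wordmx y (ordmem A).
Proof. by rewrite /wordmx big_filter. Qed.

Lemma eq_wordmx y z s : {in s, y =1 z} -> wordmx y s = wordmx z s.
Proof. by move=> yz; rewrite /wordmx; apply: eq_big_seq => i /yz. Qed.

Lemma comm_wordmx x y s : (forall i, i \in s -> GRing.comm x (y i)) ->
  GRing.comm x (wordmx y s).
Proof.
rewrite /wordmx; elim: s => [|i s IHs] xy; first by rewrite big_nil; apply: commr1.
rewrite big_cons; apply: commrM; first by apply: xy; rewrite mem_head.
by apply: IHs => k ks; apply: xy; rewrite inE ks orbT.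
Qed.

Lemma monomx_split A j : j \in A -> exists s1 s2,
  [/\ j \notin s1, j \notin s2 &
     forall y, monomx y A = wordmx y s1 * y j * wordmx y s2].
Proof.
move=> jA; have jE : j \in ordmem A by rewrite mem_ordmem.
have := ordmem_uniq A; case/splitPr: (jE) (monomx_word^~ A) => s1 s2 yE.
rewrite cat_uniq /= => /and3P[_ /norP[jNs1 _] /andP[jNs2 _]].
exists s1, s2; split=> // y; rewrite yE /wordmx big_cat big_cons /=.
by rewrite mulrA.
Qed.

Lemma anti_wordmx x y s : (forall i, i \in s -> x * y i = - (y i * x)) ->
  x * wordmx y s = (-1) ^+ size s *: (wordmx y s * x).
Proof.
elim: s => [|i s IHs] xy; first by rewrite /wordmx big_nil mul1r mulr1 scale1r.
rewrite /wordmx big_cons -/(wordmx y s) mulrA xy ?mem_head // mulNr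
  -[y i * x * _]mulrA IHs; last first.
  by move=> k ks; apply: xy; rewrite inE ks orbT.
by rewrite /= exprS mulN1r scaleNr mxscaleMr !mulrA.
Qed.

(** When [y j] squares to 1 and anticommutes with the others, multiplying a
monomial by one of its factors removes that factor.  The sign and the remaining
word depend on [A] and [j] only, so the partial derivative in direction [j]
involves no [y j]. *)
Lemma mul_monomx A j : j \in A -> exists a : C, exists2 s, j \notin s &
  forall y, (forall i, i != j -> y j * y i = - (y i * y j)) -> y j * y j = 1 ->
    y j * monomx y A = a *: wordmx y s.
Proof.
move=> /monomx_split[s1 [s2 [jNs1 jNs2 yE]]].
exists ((-1) ^+ size s1), (s1 ++ s2); first by rewrite mem_cat negb_or jNs1.
move=> y yanti ysq; rewrite yE !mulrA (@anti_wordmx (y j) y s1); last first.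
  by move=> i is1; apply: yanti; apply: contraNneq jNs1 => <-.
rewrite !mxscaleMl -[_ * y j * y j]mulrA ysq mulr1.
by rewrite /wordmx big_cat.
Qed.

Lemma comm_partialD x y c j :
  (forall i, i != j -> y j * y i = - (y i * y j)) -> y j * y j = 1 ->
  (forall i, i != j -> GRing.comm x (y i)) -> GRing.comm x (partialD y c j).
Proof.
move=> yanti ysq xy; apply: commr_sum => A jA.
have [a [s jNs ->]] := mul_monomx jA => //.
rewrite /GRing.comm !mxscaleMr !mxscaleMl; congr (_ *: (_ *: _)).
by apply: comm_wordmx => i is_; apply: xy; apply: contraNneq jNs => <-.
Qed.

Lemma conj_wordmx (U : M) y s : U * U^t* = 1 -> U^t* * U = 1 ->
  wordmx (fun i => U * y i * U^t*) s = U * wordmx y s * U^t*.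
Proof.
move=> UU UU'; rewrite /wordmx; elim: s => [|i s IHs]; first by rewrite !big_nil mulr1 UU.
by rewrite !big_cons IHs !mulrA -[_ * U^t* * U]mulrA UU' mulr1.
Qed.

Lemma conj_monomx (U : M) y A : U * U^t* = 1 -> U^t* * U = 1 ->
  monomx (fun i => U * y i * U^t*) A = U * monomx y A * U^t*.
Proof. by move=> UU UU'; rewrite !monomx_word conj_wordmx. Qed.

Lemma conj_lincomb (U : M) y c : U * U^t* = 1 -> U^t* * U = 1 ->
  lincomb (fun i => U * y i * U^t*) c = U * lincomb y c * U^t*.
Proof.
move=> UU UU'; rewrite mulr_sumr mulr_suml; apply: eq_bigr => A _.
by rewrite conj_monomx // mxscaleMr mxscaleMl.
Qed.

Lemma conj_partialD (U : M) y c j : U * U^t* = 1 -> U^t* * U = 1 ->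
  partialD (fun i => U * y i * U^t*) c j = U * partialD y c j * U^t*.
Proof.
move=> UU UU'; rewrite mulr_sumr mulr_suml; apply: eq_bigr => A _.
by rewrite conj_monomx // mxscaleMr mxscaleMl !mulrA -[_ * U^t* * U]mulrA UU' mulr1.
Qed.

End Monomials.

(** * Rotating a family of fermions into an independent copy *)

(** Two anticommuting copies [q], [q'] of the fermions and a partial isometry [e]
making Hermitian dilations possible.  The unitary [g j] implements the sign change
of [q' j] alone: averaging over it kills every monomial containing [q' j], and it
produces the exchangeable pairs of Stein's method. *)
Record fermion_double (C : numClosedFieldType) (m n : nat)
    (q q' : 'I_n -> 'M[C]_m) (e : 'M[C]_m) (g : 'I_n -> 'M[C]_m) : Prop := FermionDouble {
  fd_herm : forall i, (q i)^t* = q i;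
  fd_herm' : forall i, (q' i)^t* = q' i;
  fd_sq : forall i, q i * q i = 1;
  fd_sq' : forall i, q' i * q' i = 1;
  fd_anti : forall i j, i != j -> q i * q j = - (q j * q i);
  fd_anti' : forall i j, i != j -> q' i * q' j = - (q' j * q' i);
  fd_cross : forall i j, q i * q' j = - (q' j * q i);
  fd_eq : forall i, e * q i = - (q i * e);
  fd_eq' : forall i, e * q' i = - (q' i * e);
  fd_ee : e * e = 0;
  fd_e1 : e * e^t* + e^t* * e = 1;
  fd_gg : forall j, g j * (g j)^t* = 1;
  fd_gg' : forall j, (g j)^t* * g j = 1;
  fd_ge : forall j, GRing.comm (g j) e;
  fd_gq : forall i j, GRing.comm (g j) (q i);
  fd_gq'i : forall i j, i != j -> GRing.comm (g j) (q' i);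
  fd_gq'j : forall j, g j * q' j = - (q' j * g j)
}.

Section Double.
Variables (C : numClosedFieldType) (m n : nat).
Local Notation M := 'M[C]_m.
Variables (q q' : 'I_n -> M) (e : M) (g : 'I_n -> M).
Hypothesis fd : fermion_double q q' e g.
Implicit Types (c : {set 'I_n} -> C) (x y : M) (a b : C).

Lemma comm_adj x y : GRing.comm x y -> GRing.comm (x^t*) (y^t*).
Proof. by move=> xy; rewrite /GRing.comm -!adjM xy. Qed.

Lemma qq'q i : q i * q' i * q i = - q' i.
Proof. by rewrite (fd_cross fd) mulNr -mulrA (fd_sq fd) mulr1. Qed.

Lemma q'qq' i : q' i * q i * q' i = - q i.
Proof. by rewrite -mulrA (fd_cross fd) mulrN mulrA (fd_sq' fd) mul1r. Qed.

Lemma comm_pair x i : x * q i = - (q i * x) -> x * q' i = - (q' i * x) ->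
  GRing.comm x (q i * q' i).
Proof.
by move=> xq xq'; rewrite /GRing.comm mulrA xq mulNr
  -[q i * x * _]mulrA xq' mulrN opprK mulrA.
Qed.

Section Rotor.
Variables (a b : C).
Hypotheses (aR : a \is Num.real) (bR : b \is Num.real) (ab1 : a ^+ 2 + b ^+ 2 = 1).

(** Since [q_i q'_i] squares to [-1], this is the exponential of a multiple of
[q_i q'_i]; conjugation by it rotates the plane of [q_i] and [q'_i] by twice the
angle of [(a, b)]. *)
Definition rotor i : M := a *: (1 : M) + b *: (q i * q' i).

Lemma rotor_adj i : (rotor i)^t* = a *: (1 : M) - b *: (q i * q' i).
Proof.
rewrite /rotor adjmxD !adjmxZ !(CrealP _) // adjmx1 adjM (fd_herm fd) (fd_herm' fd).
by rewrite (fd_cross fd) scalerN opprK.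
Qed.

Let pairK i : q i * q' i * (q i * q' i) = -1.
Proof. by rewrite mulrA qq'q mulNr (fd_sq' fd). Qed.

Lemma rotorK i : (rotor i)^t* * rotor i = 1.
Proof.
rewrite rotor_adj /rotor mulrBl !mulrDr !mxscaleMl !mxscaleMr !mul1r !mulr1 pairK.
move: (q i * q' i) (1 : M) => r u; apply/matrixP => k l; rewrite !mxE.
by rewrite -[RHS]mul1r -ab1; ring.
Qed.

Lemma rotor_comm i x : GRing.comm x (q i * q' i) -> GRing.comm x (rotor i).
Proof.
move=> xr; rewrite /GRing.comm /rotor mulrDl mulrDr !mxscaleMl !mxscaleMr.
by rewrite mulr1 mul1r xr.
Qed.

Lemma rotor_fix i x : GRing.comm x (q i * q' i) -> (rotor i)^t* * x * rotor i = x.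
Proof. by move=> /rotor_comm xr; rewrite -mulrA xr mulrA rotorK mul1r. Qed.

Lemma rotor_q i : (rotor i)^t* * q i * rotor i =
  (a ^+ 2 - b ^+ 2) *: q i + (2 * a * b) *: q' i.
Proof.
have qr : q i * (q i * q' i) = q' i by rewrite mulrA (fd_sq fd) mul1r.
have q'r : q' i * (q i * q' i) = - q i by rewrite mulrA q'qq'.
rewrite rotor_adj mulrBl !mxscaleMl mul1r qq'q scalerN opprK /rotor.
rewrite mulrDr !mxscaleMr mulr1 mulrDl !mxscaleMl qr q'r.
by apply/matrixP => k l; rewrite !mxE; ring.
Qed.

Lemma rotor_q' i : (rotor i)^t* * q' i * rotor i =
  (a ^+ 2 - b ^+ 2) *: q' i - (2 * a * b) *: q i.
Proof.
have qr : q i * (q i * q' i) = q' i by rewrite mulrA (fd_sq fd) mul1r.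
have q'r : q' i * (q i * q' i) = - q i by rewrite mulrA q'qq'.
rewrite rotor_adj mulrBl !mxscaleMl mul1r -[q i * q' i * q' i]mulrA (fd_sq' fd) mulr1.
rewrite /rotor mulrDr !mxscaleMr mulr1 mulrBl !mxscaleMl qr q'r.
by apply/matrixP => k l; rewrite !mxE; ring.
Qed.

(** The product of the rotors along [s].  A rotor commutes with [q_j], [q'_j] for
[j] different from its own index, so that the factors act independently. *)
Lemma rotors s : uniq s -> exists V : M,
  [/\ V^t* * V = 1, GRing.comm V e,
   forall j, j \in s -> V^t* * q j * V = (a ^+ 2 - b ^+ 2) *: q j + (2 * a * b) *: q' j /\
                V^t* * q' j * V = (a ^+ 2 - b ^+ 2) *: q' j - (2 * a * b) *: q j &
   forall j, j \notin s -> V^t* * q j * V = q j /\ V^t* * q' j * V = q' j].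
Proof.
elim: s => [_|i s IHs /= /andP[iNs /IHs[V [VV Ve Vin Vout]]]].
  exists 1; split=> //; rewrite ?adjmx1 ?mulr1 //; first exact: commr_sym (commr1 _).
  by move=> j _; rewrite !mulr1 !mul1r.
exists (rotor i * V); split.
- by rewrite adjM mulrA -[_ * _ * rotor i]mulrA rotorK mulr1.
- apply: commr_sym; apply: commrM; last exact: commr_sym.
  by apply: rotor_comm; apply: comm_pair; [apply: (fd_eq fd)|apply: (fd_eq' fd)].
- move=> j; rewrite inE adjM => js.
  have rV x : V^t* * (rotor i)^t* * x * (rotor i * V)
    = V^t* * ((rotor i)^t* * x * rotor i) * V.
    by rewrite !mulrA.
  rewrite !rV; have [->|jNi] := eqVneq j i.
    rewrite rotor_q rotor_q' mulrDr mulrBr mulrDl mulrBl !mxscaleMr !mxscaleMl.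
    by have [-> ->] := Vout i iNs.
  rewrite (negbTE jNi) /= in js.
  rewrite !rotor_fix; first exact: Vin.
    by apply: comm_pair; [rewrite (fd_cross fd) opprK | apply: (fd_anti' fd)].
  by apply: comm_pair; [apply: (fd_anti fd) | apply: (fd_cross fd)].
- move=> j; rewrite inE negb_or adjM => /andP[jNi jNs].
  have rV x : V^t* * (rotor i)^t* * x * (rotor i * V)
    = V^t* * ((rotor i)^t* * x * rotor i) * V.
    by rewrite !mulrA.
  rewrite !rV !rotor_fix; first exact: Vout.
    by apply: comm_pair; [rewrite (fd_cross fd) opprK | apply: (fd_anti' fd)].
  by apply: comm_pair; [apply: (fd_anti fd) | apply: (fd_cross fd)].
Qed.

End Rotor.

Lemma rotation (co si : C) : 0 <= co -> si \is Num.real -> co ^+ 2 + si ^+ 2 = 1 ->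
  exists V : M, [/\ V^t* * V = 1, GRing.comm V e,
    forall j, V^t* * q j * V = co *: q j + si *: q' j &
    forall j, V^t* * q' j * V = co *: q' j - si *: q j].
Proof.
(* Cosine and sine of the half angle. *)
move=> co0 siR cs1; pose a := sqrtC ((1 + co) / 2); pose b := si / (2 * a).
have a2 : a ^+ 2 = (1 + co) / 2 by rewrite sqrtCK.
have a0 : 0 < a by rewrite sqrtC_gt0 divr_gt0 ?ltr0n // ltr_pwDl.
have aR : a \is Num.real by rewrite ger0_real // ltW.
have bR : b \is Num.real by rewrite rpred_div // realM // realn.
have ab : 2 * a * b = si by rewrite /b mulrC divfK // mulf_neq0 ?pnatr_eq0 // gt_eqF.
have a2N0 : a ^+ 2 != 0 by rewrite expf_neq0 // gt_eqF.
have co1 : 1 + co != 0 by rewrite gt_eqF // ltr_pwDl.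
have b2 : b ^+ 2 = (1 - co) / 2.
  apply: (mulfI (mulf_neq0 (_ : 4 != 0) a2N0)); first by rewrite pnatr_eq0.
  have -> : 4 * a ^+ 2 * b ^+ 2 = (2 * a * b) ^+ 2 by ring.
  rewrite ab a2; have -> : si ^+ 2 = 1 - co ^+ 2 by rewrite -cs1; ring.
  by field.
have [|V [VV Ve Vin _]] := @rotors a b aR bR _ (index_enum 'I_n) (index_enum_uniq _).
  by rewrite a2 b2; field.
have ab2 : a ^+ 2 - b ^+ 2 = co by rewrite a2 b2; field.
exists V; split=> // j; have [] := Vin j (mem_index_enum j); by rewrite ab2 ab.
Qed.

End Double.

(** * Hermitian dilation and traces of rotated monomials *)

Section Dilation.
Variables (C : numClosedFieldType) (m n : nat).
Local Notation M := 'M[C]_m.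
Variables (q q' : 'I_n -> M) (e : M) (g : 'I_n -> M).
Hypothesis fd : fermion_double q q' e g.
Implicit Types (c : {set 'I_n} -> C) (x y : M) (a b : C).

(** Hermitian dilation.  When [x] commutes with the complementary projections
[e e^*] and [e^* e], this matrix is off-diagonal for them, and [e] identifies its
two blocks with [x] and [x^*]. *)
Definition hat x : M := e * x + x^t* * e^t*.

Lemma hat_herm x : (hat x)^t* = hat x.
Proof. by rewrite /hat adjmxD !adjM !trmxCK addrC. Qed.

Lemma hatD x y : hat (x + y) = hat x + hat y.
Proof. by rewrite /hat adjmxD mulrDr mulrDl addrACA. Qed.

Lemma hatB x y : hat (x - y) = hat x - hat y.
Proof. by rewrite hatD; congr (_ + _); rewrite /hat adjmxN mulrN mulNr opprD. Qed.

Lemma hat0 : hat 0 = 0.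
Proof. by rewrite /hat trmx0 map_mx0 mulr0 mul0r addr0. Qed.

Lemma hat_sum (I : Type) (r : seq I) (P : pred I) (F : I -> M) :
  hat (\sum_(i <- r | P i) F i) = \sum_(i <- r | P i) hat (F i).
Proof. by elim/big_rec2: _ => [|i x y _ <-]; rewrite ?hat0 ?hatD. Qed.

Lemma hatZ a x : a \is Num.real -> hat (a *: x) = a *: hat x.
Proof. by move=> aR; rewrite /hat adjmxZ (CrealP aR) mxscaleMl mxscaleMr scalerDr. Qed.

Lemma comm_unitary_adj (u x : M) : u * u^t* = 1 -> u^t* * u = 1 ->
  GRing.comm u x -> GRing.comm u (x^t*).
Proof.
move=> uu uu' /(congr1 (fun w : M => w^t*)); rewrite !adjM => ux.
rewrite /GRing.comm -[LHS]mulr1 -uu' mulrA -[u * _ * _]mulrA ux.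
by rewrite !mulrA uu mul1r.
Qed.

Lemma comm_hat (u x : M) : u * u^t* = 1 -> u^t* * u = 1 ->
  GRing.comm u e -> GRing.comm u x -> GRing.comm u (hat x).
Proof.
move=> uu uu' ue ux; apply: commrD; apply: commrM => //; exact: comm_unitary_adj.
Qed.

Lemma conj_hat (u x : M) : u * u^t* = 1 -> u^t* * u = 1 -> GRing.comm u e ->
  u * hat x * u^t* = hat (u * x * u^t*).
Proof.
move=> uu uu' ue; have ue' := comm_unitary_adj uu uu' ue.
rewrite /hat mulrDr mulrDl !adjM trmxCK !mulrA ue; congr (_ + _).
by rewrite -!mulrA; congr (_ * (_ * _)); rewrite comm_adj.
Qed.

Lemma mxtr_hat x (W : M) : W^t* = W ->
  \tr (hat x * W) = \tr (e * x * W) + (\tr (e * x * W))^*.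
Proof.
move=> hW; rewrite mulrDl linearD /=; congr (_ + _).
by rewrite -mxtr_adj !adjM hW mxtrC.
Qed.

Lemma mxtr_anti0 (u x : M) : u * u^t* = 1 -> u^t* * u = 1 ->
  u * x = - (x * u) -> \tr x = 0.
Proof.
move=> uu uu' ux; apply/eqP; suff: \tr x *+ 2 == 0 by rewrite mulrn_eq0.
by rewrite mulr2n -{1}(mxtr_conj x uu') ux mulNr -mulrA uu mulr1 linearN /= addrC subrr.
Qed.

(** Expanding the product, a term containing some [q'_j] contains it once, so it
anticommutes with [g j] and has trace 0. *)
Lemma mxtr_word_kill s (a b : 'I_n -> C) (W : M) : uniq s ->
  (forall j, GRing.comm (g j) W) ->
  \tr (wordmx (fun i => a i *: q i + b i *: q' i) s * W) =
  (\prod_(i <- s) a i) * \tr (wordmx q s * W).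
Proof.
move=> us gW; have {gW} : {in s, forall j, GRing.comm (g j) W} by [].
elim: s us W => [_ W _|i s IHs /= /andP[iNs us] W gW].
  by rewrite /wordmx !big_nil !mul1r.
have gWi : GRing.comm (g i) W by apply: gW; rewrite mem_head.
rewrite /wordmx !big_cons -/(wordmx _ s) -/(wordmx q s).
rewrite -mulrA mxtrC -mulrA IHs //; last first.
  move=> j js; apply: commrM; first by apply: gW; rewrite inE js orbT.
  apply: commrD; rewrite /GRing.comm mxscaleMl mxscaleMr; congr (_ *: _).
    exact: (fd_gq fd).
  by apply: (fd_gq'i fd); apply: contraNneq iNs => ->.
rewrite mulrDr mulrDr linearD /= mxscaleMr mxscaleMr mxscaleMr mxscaleMr !linearZ /=.
rewrite [X in _ * (_ + _ * X)](@mxtr_anti0 (g i)) ?(fd_gg fd) ?(fd_gg' fd) //; last first.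
  have gX : GRing.comm (g i) (wordmx q s * W).
    apply: commrM => //; apply: comm_wordmx => j _; exact: (fd_gq fd).
  by rewrite !mulrA -[g i * _ * W]mulrA gX -!mulrA (fd_gq'j fd) !mulrN.
by rewrite mulr0 addr0 mulrCA mulrA mulrA [in LHS]mxtrC !mulrA.
Qed.

Section Rotated.
Variables (co si : C) (V : M).
Hypotheses (coR : co \is Num.real) (siR : si \is Num.real) (cs1 : co ^+ 2 + si ^+ 2 = 1).
Hypotheses (VV : V^t* * V = 1) (Ve : GRing.comm V e).
Hypotheses (Vq : forall j, V^t* * q j * V = co *: q j + si *: q' j).
Hypotheses (Vq' : forall j, V^t* * q' j * V = co *: q' j - si *: q j).

Let VV' : V * V^t* = 1. Proof. exact: mulmx1C. Qed.

Lemma rotated_q j : V * q j * V^t* = co *: q j - si *: q' j.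
Proof.
have conjK x : V * (V^t* * x * V) * V^t* = x.
  by rewrite !mulrA VV' mul1r -mulrA VV' mulr1.
rewrite -(conjK (co *: q j - si *: q' j)); congr (_ * _ * _).
rewrite mulrBr mulrBl !mxscaleMr !mxscaleMl Vq Vq'.
rewrite -[LHS]scale1r -cs1.
move: (q j) (q' j) => x y.
by apply/matrixP => k l; rewrite !mxE; ring.
Qed.

(** Move the conjugation by [V] onto the other factor.  The bivector [q'_j q_j] is
invariant under the rotation, and multiplying the rotated monomial by it turns the
factor [c q_j + s q'_j] into [c q'_j - s q_j].  Only the terms without [q'] survive
in the trace: this leaves [- s] from the factor [j] and [c] from each of the
[|A| - 1] others. *)
Lemma mxtr_rotated_term (A : {set 'I_n}) j (Z : M) : j \in A -> (forall j,
  GRing.comm (g j) Z) ->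
  \tr (e * (q' j * (q j * monomx q A)) * (V * Z * V^t*)) =
  - (si * co ^+ #|A|.-1) * \tr (e * monomx q A * Z).
Proof.
move=> jA gZ.
have -> : \tr (e * (q' j * (q j * monomx q A)) * (V * Z * V^t*)) =
    \tr (e * ((V^t* * (q' j) * V) * (V^t* * q j * V) * (V^t* * monomx q A * V)) * Z).
  have Ve' : GRing.comm (V^t*) e.
    rewrite -[e]trmxCK; apply: comm_adj; exact: comm_unitary_adj.
  rewrite [in LHS]mulrA [in LHS]mxtrC !mulrA Ve'.
  by rewrite -!(mulrA _ V (V^t*)) VV' !mulr1.
have -> : V^t* * q' j * V * (V^t* * q j * V) = q' j * q j.
  rewrite Vq Vq' mulrBl !mulrDr !mxscaleMl !mxscaleMr (fd_sq fd) (fd_sq' fd) (fd_cross fd).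
  move: (q' j * q j) (1 : M) => x u.
  rewrite -[RHS]scale1r -cs1.
  by apply/matrixP => k l; rewrite !mxE; ring.
(* Coefficients of the rotated monomial after multiplication by [q'_j q_j]. *)
pose z i := (if i == j then - si else co) *: q i + (if i == j then co else si) *: q' i.
have -> : q' j * q j * (V^t* * monomx q A * V) = monomx z A.
  have {2}-> : V = V^t*^t* by rewrite trmxCK.
  rewrite -conj_monomx ?trmxCK //.
  have [s1 [s2 [jNs1 jNs2 yE]]] := monomx_split C m jA; rewrite !yE.
  have zE s : j \notin s -> wordmx (fun i => V^t* * q i * V) s = wordmx z s.
    move=> jNs; apply: eq_wordmx => i is_ /=; rewrite Vq /z.
    by rewrite (_ : i == j = false) //; apply: contraNF jNs => /eqP <-.
  rewrite !zE // Vq !mulrA; have -> : q' j * q j * wordmx z s1 = wordmx z s1 * (q' j * q j).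
    apply: comm_wordmx => i is1.
    have iNj : i != j by apply: contraNneq jNs1 => <-.
    have jNi : j != i by rewrite eq_sym.
    rewrite /z (negbTE iNj); apply: commr_sym.
    rewrite -[q' j * q j]opprK -(fd_cross fd); apply: commrN.
    apply: comm_pair; rewrite mulrDl mulrDr !mxscaleMl !mxscaleMr.
      by rewrite (fd_anti fd) // (fd_cross fd j i) !scalerN opprD opprK.
    by rewrite (fd_anti' fd) // (fd_cross fd i j) !scalerN opprD.
  congr (_ * _); rewrite -mulrA; congr (_ * _); rewrite mulrDr !mxscaleMr.
  rewrite -mulrA (fd_sq fd) mulr1 (q'qq' fd) /z eqxx scalerN scaleNr addrC //.
rewrite -mulrA mxtrC -mulrA monomx_word mxtr_word_kill ?ordmem_uniq //; last first.
  by move=> i; apply: commrM => //; apply: (fd_ge fd).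
rewrite -monomx_word mulrA mxtrC mulrA; congr (_ * _).
rewrite big_filter (bigD1 j) //= eqxx -mulNr; congr (_ * _).
rewrite (eq_bigr (fun=> co)); last by move=> i /andP[_ /negbTE ->].
rewrite prodr_const; congr (_ ^+ _).
by rewrite [in RHS](cardsD1 j) jA /=; apply: eq_card => i; rewrite !inE andbC.
Qed.

End Rotated.

End Dilation.

(** * Squares of the dilated gradient *)

Section Moments.
Variables (C : numClosedFieldType) (m n : nat).
Local Notation M := 'M[C]_m.
Variables (q q' : 'I_n -> M) (e : M) (g : 'I_n -> M).
Hypothesis fd : fermion_double q q' e g.
Implicit Types (x W : M) (y : 'I_n -> M).
Variables (c : {set 'I_n} -> C) (G : C).

(** The operator inequalities [sum_j E_j E_j^* <= G] and [sum_j E_j^* E_j <= G] for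
the partial derivatives [E_j], tested against traces; only traces occur in the
sequel. *)
Definition grad_bounded y : Prop :=
  (forall W, \sum_j \tr (W^t* * (partialD y c j * (partialD y c j)^t*) * W)
    <= G * \tr (W^t* * W)) /\
  (forall W, \sum_j \tr (W^t* * ((partialD y c j)^t* * partialD y c j) * W)
    <= G * \tr (W^t* * W)).

(** What the original fermions and the rotated ones have in common.  The partial
derivative in direction [j] is a polynomial in the [y i], [i <> j], hence commutes
with [e q'_j] and with [g j]. *)
Record fermion_like y : Prop := FermionLike {
  fl_herm : forall i, (y i)^t* = y i;
  fl_sq : forall i, y i * y i = 1;
  fl_anti : forall i j, i != j -> y i * y j = - (y j * y i);
  fl_f : forall i j, i != j -> GRing.comm (e * q' j) (y i);
  fl_g : forall i j, i != j -> GRing.comm (g j) (y i)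
}.

Local Notation B y j := (hat e (q' j * partialD y c j)).

Lemma comm_like_partialD y j x : fermion_like y ->
  (forall i, i != j -> GRing.comm x (y i)) -> GRing.comm x (partialD y c j).
Proof.
move=> fl; apply: comm_partialD; last exact: (fl_sq fl).
by move=> i iNj; apply: (fl_anti fl); rewrite eq_sym.
Qed.

Lemma anti_adj x z : x * z = - (z * x) -> x^t* * z^t* = - (z^t* * x^t*).
Proof. by move=> xz; rewrite -adjM -[in RHS]adjM xz adjmxN opprK. Qed.

Lemma e_proj : [/\ e * e^t* * e = e, e^t* * e * e^t* = e^t*, e^t* * e^t* = 0
  & e * e^t* * (e * e^t*) = e * e^t*].
Proof.
have eee : e * e^t* * e = e.
  by rewrite -[RHS]mul1r -(fd_e1 fd) mulrDl -[e^t* * e * e]mulrA (fd_ee fd) mulr0 addr0.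
split=> //.
- by have := congr1 (fun w : M => w^t*) eee; rewrite !adjM trmxCK mulrA.
- by rewrite -adjM (fd_ee fd) trmx0 map_mx0.
- by rewrite mulrA eee.
Qed.

(** Put [f = e q'_j], so that the matrix squared is [f E + E^* f^*].  Since [f]
commutes with [E] and [E^*] and squares to 0, only the cross terms remain, and
[f f^* = e e^*], [f^* f = e^* e]. *)
Lemma hat_sq y j : fermion_like y ->
  let E := partialD y c j in
  B y j * B y j = (e * e^t*) * (E * E^t*) * (e * e^t*)
    + (e^t* * e) * (E^t* * E) * (e^t* * e).
Proof.
move=> fl E; pose f := e * q' j; have [eee eee' ee' pp] := e_proj.
have fE : GRing.comm f E by apply: comm_like_partialD => // i; apply: (fl_f fl).
have f'E : GRing.comm (f^t*) E.
  apply: comm_like_partialD => // i /(fl_f fl)/comm_adj; by rewrite (fl_herm fl).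
have fE' : GRing.comm f (E^t*) by rewrite -[f]trmxCK; apply: comm_adj.
have f'E' : GRing.comm (f^t*) (E^t*) by apply: comm_adj.
have f'e : f^t* = q' j * e^t* by rewrite adjM (fd_herm' fd).
have ff : f * f = 0.
  by rewrite /f -mulrA [q' j * _]mulrA -[q' j * e]opprK -(fd_eq' fd) mulNr mulrN
    -!mulrA mulrA (fd_ee fd) mul0r oppr0.
have ff' : f^t* * f^t* = 0 by rewrite -adjM ff trmx0 map_mx0.
have p1 : f * f^t* = e * e^t* by rewrite f'e /f -mulrA [q' j * _]mulrA (fd_sq' fd) mul1r.
have p2 : f^t* * f = e^t* * e.
  have e'q' : e^t* * q' j = - (q' j * e^t*).
    by rewrite -{1}(fd_herm' fd) anti_adj ?(fd_eq' fd) // (fd_herm' fd).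
  rewrite f'e /f -[q' j * e^t*]opprK -e'q' mulNr -mulrA.
  by rewrite -[q' j * _]opprK (_ : q' j * (e * q' j) = - e) ?opprK ?mulrN ?opprK // mulrA
    -[q' j * e]opprK -(fd_eq' fd) mulNr -mulrA (fd_sq' fd) mulr1.
have -> : B y j = f * E + E^t* * f^t* by rewrite /hat adjM f'e (fd_herm' fd) /f !mulrA.
clearbody f.
have pE : (e * e^t*) * (E * E^t*) * (e * e^t*) = E * E^t* * (e * e^t*).
  have : GRing.comm (e * e^t*) (E * E^t*).
    by rewrite -p1; apply: commr_sym; apply: commrM; apply: commr_sym; apply: commrM.
  by move=> ->; rewrite -mulrA pp.
have pE' : (e^t* * e) * (E^t* * E) * (e^t* * e) = E^t* * E * (e^t* * e).
  have : GRing.comm (e^t* * e) (E^t* * E).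
    by rewrite -p2; apply: commr_sym; apply: commrM; apply: commr_sym; apply: commrM.
  by move=> ->; rewrite -mulrA [e^t* * e * _]mulrA eee'.
rewrite pE pE' -p1 -p2 mulrDl !mulrDr.
have -> : f * E * (f * E) = 0 by rewrite -expr2 exprMn_comm // expr2 ff mul0r.
have -> : E^t* * f^t* * (E^t* * f^t*) = 0.
  by rewrite -expr2 exprMn_comm; [rewrite !expr2 ff' mulr0 | apply: commr_sym].
rewrite add0r addr0; congr (_ + _).
  by rewrite mulrA fE -[E * f * _]mulrA fE' !mulrA.
rewrite -!mulrA; congr (_ * _); rewrite mulrA.
have Eff : GRing.comm E (f^t* * f) by apply: commrM; apply: commr_sym.
by rewrite Eff.
Qed.

(** The two blocks of [hat_sq] are bounded by the two halves of the gradient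
bound, on the complementary projections [e e^*] and [e^* e].  This is why both
[|D_j T|^2] and [|D_j T^*|^2] enter the gradient. *)
Lemma sum_hat_bound y W : fermion_like y -> grad_bounded y ->
  \sum_j \tr (W^t* * (B y j * B y j) * W) <= G * \tr (W^t* * W).
Proof.
move=> fl [bd1 bd2]; have [eee eee' ee' pp] := e_proj.
have p2 : e^t* * e * (e^t* * e) = e^t* * e by rewrite mulrA eee'.
pose W1 := e * e^t* * W; pose W2 := e^t* * e * W.
have -> : \tr (W^t* * W) = \tr (W1^t* * W1) + \tr (W2^t* * W2).
  rewrite -linearD /=; congr (\tr _); rewrite /W1 /W2 !adjM !trmxCK.
  transitivity (W^t* * (e * e^t* * (e * e^t*) + e^t* * e * (e^t* * e)) * W).
    by rewrite pp p2 (fd_e1 fd) mulr1.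
  by rewrite mulrDr mulrDl !mulrA.
rewrite mulrDr; apply: le_trans (lerD (bd1 W1) (bd2 W2)).
rewrite -big_split /= le_eqVlt; apply/orP; left; apply/eqP.
apply: eq_bigr => j _; rewrite (hat_sq _ fl) -linearD /=; congr (\tr _).
by rewrite /W1 /W2 !adjM !trmxCK mulrDr mulrDl !mulrA.
Qed.

Lemma g_anti_hat y j : fermion_like y -> g j * B y j = - (B y j * g j).
Proof.
move=> fl; have gE : GRing.comm (g j) (partialD y c j).
  by apply: comm_like_partialD => // i; apply: (fl_g fl).
have gE' := comm_unitary_adj (fd_gg fd j) (fd_gg' fd j) gE.
have ge' := comm_unitary_adj (fd_gg fd j) (fd_gg' fd j) (fd_ge fd j).
have gq := fd_gq'j fd j.
rewrite /hat adjM (fd_herm' fd) mulrDr mulrDl opprD; congr (_ + _).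
  rewrite mulrA (fd_ge fd) -mulrA [g j * _]mulrA gq mulNr -[q' j * g j * _]mulrA gE.
  by rewrite mulrN !mulrA.
rewrite !mulrA gE' -[_ * g j * _]mulrA gq mulrN mulNr -!mulrA; congr (- (_ * (_ * _))).
exact: ge'.
Qed.

(** [mxtr_stein] for each [j], summed with the gradient bound; the even power
[Y^(2k)] is split as [Y^k Y^k] to become the test matrix. *)
Lemma stein_sum (Y : M) y kappa k : Y^t* = Y ->
  fermion_like q -> fermion_like y -> grad_bounded q -> grad_bounded y ->
  (forall j, Y - g j * Y * (g j)^t* = (2 * kappa) *: B y j) ->
  `|\tr ((\sum_j B q j) * Y ^+ k.*2.+1)| <= `|kappa| * k.*2.+1%:R * (G * \tr (Y ^+ k.*2)).
Proof.
move=> hY flq fly bdq bdy Yg.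
have hYk : (Y ^+ k)^t* = Y ^+ k by rewrite adjmxX hY.
have trB z : fermion_like z -> grad_bounded z ->
    \sum_j \tr (B z j * Y ^+ k.*2 * B z j) <= G * \tr (Y ^+ k.*2).
  move=> flz bdz; have := sum_hat_bound (Y ^+ k) flz bdz.
  rewrite hYk -exprD addnn; apply: le_trans; rewrite le_eqVlt; apply/orP; left; apply/eqP.
  apply: eq_bigr => j _.
  by rewrite -addnn exprD mxtrC !mulrA mxtrC !mulrA.
rewrite -(ler_pM2l (ltr0n _ 2)) mulr_suml linear_sum /=.
apply: (@le_trans _ _ (\sum_j 2 * `|\tr (B q j * Y ^+ k.*2.+1)|)).
  by rewrite -mulr_sumr ler_wpM2l ?ler0n // ler_norm_sum.
apply: (@le_trans _ _ (\sum_j `|kappa| * k.*2.+1%:R *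
   (\tr (B q j * Y ^+ k.*2 * B q j) + \tr (B y j * Y ^+ k.*2 * B y j)))).
  apply: ler_sum => j _; apply: (mxtr_stein (g := g j)) => //.
  - exact: hat_herm.
  - exact: hat_herm.
  - exact: (fd_gg fd).
  - exact: (fd_gg' fd).
  - exact: g_anti_hat.
  - exact: g_anti_hat.
  - by rewrite odd_double.
rewrite -mulr_sumr mulrCA ler_wpM2l ?mulr_ge0 ?normr_ge0 ?ler0n //.
by rewrite big_split /= mulr2n mulrDl !mul1r lerD ?trB.
Qed.

End Moments.

(** * Moment inequalities *)

Section MomentBounds.
Variables (C : numClosedFieldType) (m n : nat).
Local Notation M := 'M[C]_m.
Variables (q q' : 'I_n -> M) (e : M) (g : 'I_n -> M).
Hypothesis fd : fermion_double q q' e g.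
Variables (c : {set 'I_n} -> C) (G : C).
Local Notation B y j := (hat e (q' j * partialD y c j)).
Local Notation S := (\sum_j B q j).

Lemma fermion_like_q : fermion_like q' e g q.
Proof.
split; [exact: (fd_herm fd)|exact: (fd_sq fd)|exact: (fd_anti fd)| |by move=> i j _;
  exact: (fd_gq fd)].
move=> i j _; rewrite /GRing.comm -mulrA -[q' j * q i]opprK
  -(fd_cross fd) mulrN [e * (q i * _)]mulrA.
by rewrite (fd_eq fd) mulNr opprK -mulrA.
Qed.

Lemma mxtr_even_ge0 (Y : M) k : Y^t* = Y -> 0 <= \tr (Y ^+ k.*2).
Proof. by move=> hY; rewrite -addnn exprD -{1}hY -adjmxX; apply: mxtr_sqmod_ge0. Qed.

(** The derivative at [co] of [F(x) = sum_A x^|A| tr (hat (c_A q_A) Z)]. *)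
Definition rot_sum co (Z : M) : C :=
  \sum_(A : {set 'I_n}) #|A|%:R * co ^+ #|A|.-1 * \tr (hat e (c A *: monomx q A) * Z).

Section Rotated.
Variables (co si : C) (V : M).
Hypotheses (coR : co \is Num.real) (siR : si \is Num.real) (cs1 : co ^+ 2 + si ^+ 2 = 1).
Hypotheses (VV : V^t* * V = 1) (Ve : GRing.comm V e).
Hypotheses (Vq : forall j, V^t* * q j * V = co *: q j + si *: q' j).
Hypotheses (Vq' : forall j, V^t* * q' j * V = co *: q' j - si *: q j).

Let VV' : V * V^t* = 1. Proof. exact: mulmx1C. Qed.

Local Notation r := (fun j => V * q j * V^t*).

Let rE j : r j = co *: q j - si *: q' j.
Proof. exact: (rotated_q cs1 VV Vq Vq'). Qed.

Lemma fermion_like_r : fermion_like q' e g r.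
Proof.
have cj x y : V * x * V^t* * (V * y * V^t*) = V * (x * y) * V^t*.
  by rewrite !mulrA -[_ * V^t* * V]mulrA VV mulr1.
split.
- by move=> i; rewrite !adjM trmxCK (fd_herm fd) mulrA.
- by move=> i; rewrite cj (fd_sq fd) mulr1.
- by move=> i j ij; rewrite !cj (fd_anti fd) // mulrN mulNr.
- move=> i j ij; rewrite rE.
  have f1 := fl_f fermion_like_q ij.
  have f2 : GRing.comm (e * q' j) (q' i).
    rewrite /GRing.comm -mulrA (fd_anti' fd) 1?eq_sym
      // mulrN [e * (q' i * _)]mulrA (fd_eq' fd).
    by rewrite mulNr opprK -mulrA.
  apply: commrB; rewrite /GRing.comm mxscaleMl mxscaleMr; congr (_ *: _);
    [exact: f1|exact: f2].
- move=> i j ij; rewrite rE; apply: commrB; rewrite /GRing.comm mxscaleMl mxscaleMr;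
  congr (_ *: _).
    exact: (fd_gq fd).
  exact: (fd_gq'i fd).
Qed.

Lemma grad_bounded_r : grad_bounded c G q -> grad_bounded c G r.
Proof.
have VW (W : M) : \tr (W^t* * W) = \tr ((V^t* * W)^t* * (V^t* * W)).
  by rewrite adjM trmxCK mulrA -[_ * V * _]mulrA VV' mulr1.
move=> [bd1 bd2]; split=> W; rewrite VW.
  apply: le_trans (bd1 (V^t* * W)); rewrite le_eqVlt; apply/orP; left; apply/eqP.
  apply: eq_bigr => j _; rewrite conj_partialD // !adjM !trmxCK !mulrA.
  by rewrite -!(mulrA _ (V^t*) V) VV !mulr1.
apply: le_trans (bd2 (V^t* * W)); rewrite le_eqVlt; apply/orP; left; apply/eqP.
apply: eq_bigr => j _; rewrite conj_partialD // !adjM !trmxCK !mulrA.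
by rewrite -!(mulrA _ (V^t*) V) VV !mulr1.
Qed.

(** The infinitesimal rotation of [hat (lincomb q c)] paired with the rotated
matrix [V Z V^*] is a derivative along the rotation.  Here it is computed term by
term: each [A] occurs once for every [j] in [A], which yields the factor [|A|]. *)
Lemma mxtr_rotated (Z : M) : Z^t* = Z -> (forall j, GRing.comm (g j) Z) ->
  \tr (S * (V * Z * V^t*)) = - si * rot_sum co Z.
Proof.
move=> hZ gZ; rewrite -hat_sum mxtr_hat; last by rewrite !adjM trmxCK hZ mulrA.
have -> : \tr (e * (\sum_j q' j * partialD q c j) * (V * Z * V^t*)) =
   - si * \sum_(A : {set 'I_n}) #|A|%:R * co ^+ #|A|.-1 * \tr (e * (c A *: monomx q A) * Z).
  rewrite mulr_sumr mulr_suml linear_sum /=.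
  transitivity (\sum_(j < n) \sum_(A : {set 'I_n} | j \in A)
     - si * (co ^+ #|A|.-1 * \tr (e * (c A *: monomx q A) * Z))).
    apply: eq_bigr => j _; rewrite !mulr_sumr mulr_suml linear_sum /=.
    apply: eq_bigr => A jA.
    rewrite !mxscaleMr !mxscaleMl !linearZ /= (mxtr_rotated_term fd cs1 VV Ve Vq Vq' jA gZ).
    by ring.
  rewrite (exchange_big_dep xpredT) //= mulr_sumr; apply: eq_bigr => A _.
  by rewrite sumr_const -mulr_natl; ring.
rewrite rmorphM rmorphN /= (CrealP siR) -mulrDr; congr (_ * _).
rewrite rmorph_sum -big_split /=; apply: eq_bigr => A _.
rewrite rmorphM /= (CrealP (_ : _ \is Num.real)); last first.
  by rewrite realM ?realn ?rpredX.
by rewrite -mulrDr mxtr_hat.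
Qed.

(** The matrices [g j] map [V q_j V^* = c q_j - s q'_j] to [c q_j + s q'_j] and fix
the other rotated fermions, so [Y - g_j Y g_j^*] is [- 2 s] times the dilated
partial derivative in direction [j]: the hypothesis of [mxtr_stein] with
[kappa = - s]. *)
Lemma stein_rotated k : grad_bounded c G q ->
  `|\tr (S * (V * hat e (lincomb q c) * V^t*) ^+ k.*2.+1)| <=
   `|si| * k.*2.+1%:R * (G * \tr (hat e (lincomb q c) ^+ k.*2)).
Proof.
move=> bd; set H := hat e (lincomb q c); set Y := V * H * V^t*.
have hH : H^t* = H by exact: hat_herm.
have hY : Y^t* = Y by rewrite !adjM trmxCK hH mulrA.
have -> : \tr (H ^+ k.*2) = \tr (Y ^+ k.*2) by rewrite exprX_conj // mxtr_conj.
rewrite -[`|si|]normrN; have := @stein_sum _ _ _ _ _ _ _ fd c G Y r (- si) k hY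
  fermion_like_q fermion_like_r bd; apply.
  exact: grad_bounded_r.
move=> j; rewrite /Y /H conj_hat // conj_hat ?(fd_gg fd) ?(fd_gg' fd) //;
  last exact: (fd_ge fd).
rewrite -hatZ ?rpredM ?realn ?rpredN //.
rewrite -hatB; congr (hat e _).
rewrite -conj_lincomb // mulr_sumr mulr_suml -sumrB /partialD
  !mulr_sumr scaler_sumr big_mkcond.
rewrite [RHS]big_mkcond /=.
apply: eq_bigr => A _; rewrite mxscaleMr mxscaleMl.
have fl := fermion_like_r.
have gr i : i != j -> GRing.comm (g j) (r i) by apply: (fl_g fl).
case: ifPn => [jA|jNA]; last first.
  have -> : g j * monomx r A * (g j)^t* = monomx r A.
    have -> : g j * monomx r A = monomx r A * g j.
      rewrite monomx_word; apply: comm_wordmx => i; rewrite mem_ordmem => iA.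
      by apply: gr; apply: contraNneq jNA => <-.
    by rewrite -mulrA (fd_gg fd) mulr1.
  by rewrite subrr.
have [a [s jNs sE]] := mul_monomx C m jA.
have mE : monomx r A = r j * (r j * monomx r A) by rewrite mulrA (fl_sq fl) mul1r.
have rA : r j * monomx r A = a *: wordmx r s.
  apply: sE => [i iNj|]; last exact: (fl_sq fl).
  by apply: (fl_anti fl); rewrite eq_sym.
rewrite {1 2}mE !rA.
have gw : GRing.comm (g j) (wordmx r s).
  by apply: comm_wordmx => i is_; apply: gr; apply: contraNneq jNs => <-.
have grj : g j * r j * (g j)^t* = co *: q j + si *: q' j.
  rewrite rE mulrBr mulrBl !mxscaleMr !mxscaleMl (fd_gq fd) (fd_gq'j fd).
  by rewrite mulNr -!mulrA (fd_gg fd) !mulr1 scalerN opprK.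
have -> : g j * (r j * (a *: wordmx r s)) * (g j)^t* = (co *: q j
  + si *: q' j) * (a *: wordmx r s).
  rewrite -grj !mxscaleMr !mxscaleMl; congr (_ *: _).
  have gw' : GRing.comm ((g j)^t*) (wordmx r s).
    rewrite -[wordmx r s]trmxCK; apply: comm_adj.
    by apply: comm_unitary_adj; rewrite ?(fd_gg fd) ?(fd_gg' fd).
  by rewrite [g j * _]mulrA -[g j * _ * _ * _]mulrA -gw' mulrA.
rewrite -scalerBr -mulrBl rE [in RHS]mxscaleMr scalerA [_ * c A]mulrC -scalerA.
congr (_ *: _); rewrite -mxscaleMl; congr (_ * _).
by move: (q j) (q' j) => x x'; apply/matrixP => i l; rewrite !mxE; ring.
Qed.

End Rotated.

(** Compare [mxtr_rotated] and [stein_rotated]: both sides contain the factor [s],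
which cancels. *)
Lemma moment_stein co si k : 0 <= co -> 0 < si -> co ^+ 2 + si ^+ 2 = 1 ->
  grad_bounded c G q ->
  `|rot_sum co (hat e (lincomb q c) ^+ k.*2.+1)| <=
    k.*2.+1%:R * (G * \tr (hat e (lincomb q c) ^+ k.*2)).
Proof.
move=> co0 si0 cs1 bd; set H := hat e (lincomb q c);
  have siR : si \is Num.real by rewrite ger0_real // ltW.
have coR : co \is Num.real by rewrite ger0_real.
have [V [VV Ve Vq Vq']] := rotation fd co0 siR cs1.
have VV' : V * V^t* = 1 by exact: mulmx1C.
have hH : H^t* = H by exact: hat_herm.
have gH j : GRing.comm (g j) H.
  apply: comm_hat; [exact: (fd_gg fd)|exact: (fd_gg' fd)|exact: (fd_ge fd)|].
  apply: commr_sum => A _; rewrite /GRing.comm mxscaleMr mxscaleMl; congr (_ *: _).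
  by apply: commr_prod => i _; exact: (fd_gq fd).
have := stein_rotated siR cs1 VV Ve Vq Vq' k bd.
rewrite exprX_conj // (mxtr_rotated coR siR cs1 VV Ve Vq Vq') ?adjmxX ?hH //; last first.
  by move=> j; apply: commrX.
by rewrite normrM normrN -/H -mulrA ler_pM2l // normr_gt0 gt_eqF.
Qed.

(** Stein's estimate with [Y = S]: conjugation by [g j] reverses the sign of the
term [j] of [S] and fixes the others, so [kappa = 1] and the two families of
derivatives coincide. *)
Lemma grad_moment k : grad_bounded c G q ->
  \tr (S ^+ k.+1.*2) <= k.*2.+1%:R * (G * \tr (S ^+ k.*2)).
Proof.
move=> bd; have hS : S^t* = S by rewrite adjmx_sum; apply: eq_bigr => j _; rewrite hat_herm.
rewrite -[\tr (S ^+ k.+1.*2)]ger0_norm ?mxtr_even_ge0 // doubleS exprS.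
have flq := fermion_like_q.
have := @stein_sum _ _ _ _ _ _ _ fd c G S q 1 k hS flq flq bd bd.
rewrite normr1 mul1r; apply=> j.
rewrite mulr1 mulr_sumr mulr_suml -sumrB (bigD1 j) //= big1 ?addr0; last first.
  move=> i iNj; have -> : g j * B q i = B q i * g j.
    apply: comm_hat; [exact: (fd_gg fd)|exact: (fd_gg' fd)|exact: (fd_ge fd)|].
    apply: commrM; first exact: (fd_gq'i fd).
    by apply: commr_sum => A _; rewrite /GRing.comm mxscaleMr mxscaleMl; congr (_ *: _);
      apply: commrM; [exact: (fd_gq fd)|apply: commr_prod => ? _; exact: (fd_gq fd)].
  by rewrite -mulrA (fd_gg fd) mulr1 subrr.
rewrite (g_anti_hat fd) // mulNr -mulrA (fd_gg fd) mulr1 opprK.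
by rewrite -mulr2n -scaler_nat.
Qed.

(** The trace Young inequality for [tr (S * V H^(2k+1) V^* )].  The scale [lam] is
free and will be chosen as [K_alpha]; positivity of the first weight is what later
allows the second term to be absorbed. *)
Lemma moment_rotation k : exists ab : C * C,
  [/\ 0 < ab.1, 0 <= ab.2, ab.1 + ab.2 = 1 &
  forall (H : M) (co si lam : C), H^t* = H -> (forall j, GRing.comm (g j) H) ->
    0 <= lam -> 0 <= co -> 0 <= si -> co ^+ 2 + si ^+ 2 = 1 ->
  lam * si * `|rot_sum co (H ^+ k.*2.+1)|
   <= ab.1 * (lam ^+ k.+1.*2 * \tr (S ^+ k.+1.*2)) + ab.2 * \tr (H ^+ k.+1.*2)].
Proof.
have [[a b] /= [a0 b0 ab1 /(_ isT) a_gt0 young]] := young_weights C 1 k.*2.+1.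
exists (a, b); split=> //= H co si lam hH gH lam0 co0 si0 cs1.
have siR : si \is Num.real by rewrite ger0_real.
have coR : co \is Num.real by rewrite ger0_real.
have [V [VV Ve Vq Vq']] := rotation fd co0 siR cs1.
have VV' : V * V^t* = 1 by exact: mulmx1C.
have hS : S^t* = S by rewrite adjmx_sum; apply: eq_bigr => j _; rewrite hat_herm.
have hlS : (lam *: S)^t* = lam *: S by rewrite adjmxZ hS (CrealP (ger0_real lam0)).
have hV : (V * H * V^t*)^t* = V * H * V^t* by rewrite !adjM trmxCK hH mulrA.
have := mxtr_young (A := 1) (B := 1) hlS hV (adjmx1 _ _) (adjmx1 _ _) a0 b0 _ young.
rewrite !mul1r !mulr1 /= odd_double => /(_ isT).
rewrite expr1 mxscaleMl linearZ /= exprX_conj //.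
rewrite (mxtr_rotated coR siR cs1 VV Ve Vq Vq') ?adjmxX ?hH //; last first.
  by move=> j; apply: commrX.
have dbl (x : C) : x + x = 2 * x by ring.
rewrite !dbl [a * _]mulrCA [b * _]mulrCA -mulrDr ler_pM2l ?ltr0n //.
rewrite !normrM normrN (ger0_norm lam0) (ger0_norm si0) mulrA => /le_trans; apply.
rewrite add1n -doubleS exprX_conj // mxtr_conj // lerD2r ler_wpM2l //.
have -> : (lam *: S) ^+ k.+1.*2 = lam ^+ k.+1.*2 *: S ^+ k.+1.*2.
  elim: (k.+1.*2) => [|j IHj]; first by rewrite !expr0 scale1r.
  by rewrite !exprS IHj mxscaleMl mxscaleMr scalerA.
by rewrite linearZ.
Qed.

End MomentBounds.

(** * Tensor product realization of the doubled fermions *)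

Section TensorRealization.
Variables (C : numClosedFieldType).

Lemma adj_tens m n p r (A : 'M[C]_(m, n)) (B : 'M[C]_(p, r)) :
  (A *t B)^t* = A^t* *t B^t*.
Proof. by rewrite trmx_tens map_mxT. Qed.

Lemma tensM m n (A A' : 'M[C]_m) (B B' : 'M[C]_n) :
  (A *t B) * (A' *t B') = (A * A') *t (B * B').
Proof. exact: tensmx_mul. Qed.

Lemma tensDl m n (A A' : 'M[C]_m) (B : 'M[C]_n) : (A + A') *t B = A *t B + A' *t B.
Proof. by apply/matrixP => i j; rewrite !mxE mulrDl. Qed.

Lemma tensDr m n (A : 'M[C]_m) (B B' : 'M[C]_n) : A *t (B + B') = A *t B + A *t B'.
Proof. by apply/matrixP => i j; rewrite !mxE mulrDr. Qed.

Lemma tensZl m n a (A : 'M[C]_m) (B : 'M[C]_n) : (a *: A) *t B = a *: (A *t B).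
Proof. by apply/matrixP => i j; rewrite !mxE mulrA. Qed.

Lemma tensZr m n a (A : 'M[C]_m) (B : 'M[C]_n) : A *t (a *: B) = a *: (A *t B).
Proof. by apply/matrixP => i j; rewrite !mxE mulrCA. Qed.

Lemma tensNl m n (A : 'M[C]_m) (B : 'M[C]_n) : (- A) *t B = - (A *t B).
Proof. by rewrite -scaleN1r tensZl scaleN1r. Qed.

Lemma tensNr m n (A : 'M[C]_m) (B : 'M[C]_n) : A *t (- B) = - (A *t B).
Proof. by rewrite -scaleN1r tensZr scaleN1r. Qed.

Lemma tens11 m n : (1 : 'M[C]_m) *t (1 : 'M[C]_n) = 1.
Proof.
apply/matrixP => i j; case: (mxtens_indexP i) => i1 i2; case: (mxtens_indexP j) => j1 j2.
rewrite tensmxE !mxE -natrM mulnb; congr (_ %:R); congr (nat_of_bool _).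
apply/andP/eqP => [[/eqP -> /eqP ->]//|/(can_inj (@mxtens_indexK _ _))[-> ->]].
by split.
Qed.

Lemma mxtr_tens m n (A : 'M[C]_m) (B : 'M[C]_n) : \tr (A *t B) = \tr A * \tr B.
Proof. by rewrite /mxtrace mulr_sum; apply: eq_bigr => i _; rewrite mxE. Qed.

(** [Gm] is the parity, which anticommutes with every fermion.  It restores
anticommutation between different tensor factors, and [Q j * Gm] anticommutes with
[Q j] alone. *)
Record fermions (N n : nat) (Q : 'I_n -> 'M[C]_N) (Gm : 'M[C]_N) : Prop := Fermions {
  fm_herm : forall i, (Q i)^t* = Q i;
  fm_sq : forall i, Q i * Q i = 1;
  fm_anti : forall i j, i != j -> Q i * Q j = - (Q j * Q i);
  fm_Gherm : Gm^t* = Gm;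
  fm_Gsq : Gm * Gm = 1;
  fm_GQ : forall i, Gm * Q i = - (Q i * Gm)
}.

Variables (N n : nat) (Q : 'I_n -> 'M[C]_N) (Gm : 'M[C]_N).
Hypothesis fm : fermions Q Gm.

Lemma flip_comm j i : i != j -> GRing.comm (Q j * Gm) (Q i).
Proof.
move=> ij; rewrite /GRing.comm -mulrA (fm_GQ fm) mulrN [Q j * (Q i * _)]mulrA.
by rewrite (fm_anti fm) 1?eq_sym // mulNr opprK -mulrA.
Qed.

Lemma flip_anti j : Q j * Gm * Q j = - (Q j * (Q j * Gm)).
Proof. by rewrite -mulrA (fm_GQ fm) mulrN. Qed.

Lemma flip_unitary j : (Q j * Gm) * (Q j * Gm)^t* = 1 /\ (Q j * Gm)^t* * (Q j * Gm) = 1.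
Proof.
rewrite adjM (fm_Gherm fm) (fm_herm fm); split.
  by rewrite mulrA -[Q j * Gm * Gm]mulrA (fm_Gsq fm) mulr1 (fm_sq fm).
by rewrite mulrA -[Gm * Q j * Q j]mulrA (fm_sq fm) mulr1 (fm_Gsq fm).
Qed.

(* The factor of dimension 2 carries the block structure of the dilation; the
   parities make the other operators anticommute with one another. *)
Let e12 : 'M[C]_2 := delta_mx 0 1.
Let sz : 'M[C]_2 := delta_mx 0 0 - delta_mx 1 1.

Definition emb (x : 'M[C]_N) : 'M[C]_(2 * (N * N)) := (1 : 'M[C]_2) *t (x *t (1 : 'M[C]_N)).
Definition ferm2 i : 'M[C]_(2 * (N * N)) := (1 : 'M[C]_2) *t (Gm *t Q i).
Definition dil : 'M[C]_(2 * (N * N)) := e12 *t (Gm *t Gm).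
Definition flip j : 'M[C]_(2 * (N * N)) := sz *t ((1 : 'M[C]_N) *t (Q j * Gm)).

Let e12' : e12^t* = delta_mx 1 0.
Proof. by apply/matrixP => i j; rewrite !mxE andbC conjC_nat. Qed.

Let I2 (i : 'I_2) : {i = 0} + {i = 1}.
Proof. by case: i => [[|[|//]]] h; [left|right]; apply: val_inj. Qed.

Let dmul (i j k l : 'I_2) : (delta_mx i j : 'M[C]_2) * delta_mx k l = (j
  == k)%:R *: delta_mx i l.
Proof. by rewrite -mulmxE; case: eqP => [->|/eqP jk];
  rewrite ?mul_delta_mx ?mul_delta_mx_0 ?scale1r ?scale0r. Qed.

Let sz_herm : sz^t* = sz.
Proof.
apply/matrixP => i j; rewrite !mxE rmorphB /= !conjC_nat.
by case: (I2 i) => ->; case: (I2 j) => ->.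
Qed.

Let sz2 : sz * sz = 1.
Proof.
rewrite /sz mulrBl !mulrBr !dmul /= !scale1r !scale0r !subr0 sub0r opprK.
by apply/matrixP => i j; rewrite !mxE; case: (I2 i) => ->; case: (I2 j) => ->;
  rewrite /= ?addr0 ?add0r.
Qed.

Let sze : sz * e12 = - (e12 * sz).
Proof. by rewrite /sz /e12 mulrBl mulrBr !dmul /= !scale1r !scale0r subr0 sub0r opprK. Qed.

Lemma fermion_double_tens : fermion_double (fun i => emb (Q i)) ferm2 dil flip.
Proof.
have GQ := fm_GQ fm; have GG := fm_Gsq fm; have G' := fm_Gherm fm.
have QG i : Q i * Gm = - (Gm * Q i) by rewrite GQ opprK.
have fG j : Q j * Gm * Gm = - (Gm * (Q j * Gm)) by rewrite mulrA GQ mulNr opprK.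
have a1 n' : (1 : 'M[C]_n')^t* = 1 by exact: adjmx1.
have e0 : e12 * e12 = 0 by rewrite /e12 dmul scale0r.
split.
- by move=> i; rewrite !adj_tens !a1 (fm_herm fm).
- by move=> i; rewrite !adj_tens !a1 (fm_herm fm) G'.
- by move=> i; rewrite !tensM !mul1r (fm_sq fm) !tens11.
- by move=> i; rewrite !tensM !mul1r (fm_sq fm) GG !tens11.
- by move=> i j ij; rewrite !tensM !mul1r (fm_anti fm) // tensNl tensNr.
- by move=> i j ij; rewrite !tensM !mul1r (fm_anti fm) // !tensNr.
- by move=> i j; rewrite !tensM !mul1r !mulr1 QG tensNl tensNr.
- by move=> i; rewrite !tensM !mul1r !mulr1 GQ tensNl tensNr.
- by move=> i; rewrite !tensM !mul1r !mulr1 GQ !tensNr.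
- by rewrite !tensM e0 tens0mx.
- rewrite !adj_tens e12' !G' !tensM GG tens11 -tensDl /e12 !dmul !scale1r.
  rewrite (_ : _ + _ = 1) ?tens11 //.
  by apply/matrixP => i j; rewrite !mxE; case: (I2 i) => ->; case: (I2 j) => ->;
    rewrite /= ?addr0 ?add0r.
- by move=> j; rewrite !adj_tens sz_herm a1 !tensM sz2 mul1r (flip_unitary j).1 !tens11.
- by move=> j; rewrite !adj_tens sz_herm a1 !tensM sz2 mul1r (flip_unitary j).2 !tens11.
- by move=> j; rewrite /GRing.comm !tensM sze !mul1r !mulr1 fG !tensNr !tensNl opprK.
- by move=> i j; rewrite /GRing.comm !tensM !mul1r !mulr1.
- by move=> i j ij; rewrite /GRing.comm !tensM !mul1r !mulr1 flip_comm.
- by move=> j; rewrite !tensM !mul1r !mulr1 flip_anti !tensNr.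
Qed.

Lemma embM x y : emb (x * y) = emb x * emb y.
Proof. by rewrite !tensM !mul1r. Qed.

Lemma emb1 : emb 1 = 1. Proof. by rewrite /emb !tens11. Qed.

Lemma embD x y : emb (x + y) = emb x + emb y.
Proof. by rewrite /emb tensDl tensDr. Qed.

Lemma embZ a x : emb (a *: x) = a *: emb x.
Proof. by rewrite /emb tensZl tensZr. Qed.

Lemma emb0 : emb 0 = 0. Proof. by rewrite -(scale0r 0) embZ scale0r. Qed.

Lemma emb_sum (I : Type) (r : seq I) (P : pred I) F :
  emb (\sum_(i <- r | P i) F i) = \sum_(i <- r | P i) emb (F i).
Proof. by elim/big_rec2: _ => [|i x y _ <-]; rewrite ?emb0 ?embD. Qed.

Lemma emb_adj x : emb (x^t*) = (emb x)^t*.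
Proof. by rewrite /emb !adj_tens !adjmx1. Qed.

Lemma emb_monomx A : monomx (fun i => emb (Q i)) A = emb (monomx Q A).
Proof.
rewrite /monomx; elim/big_rec2: _ => [|i x y _ ->]; first by rewrite emb1.
by rewrite embM.
Qed.

Lemma emb_lincomb c : lincomb (fun i => emb (Q i)) c = emb (lincomb Q c).
Proof. by rewrite emb_sum; apply: eq_bigr => A _; rewrite emb_monomx embZ. Qed.

Lemma emb_partialD c j : partialD (fun i => emb (Q i)) c j = emb (partialD Q c j).
Proof. by rewrite emb_sum; apply: eq_bigr => A _; rewrite emb_monomx embZ embM. Qed.

Lemma mxtr_XC m (x y : 'M[C]_m) k : \tr ((x * y) ^+ k) = \tr ((y * x) ^+ k).
Proof.
case: k => [|k]; first by rewrite !expr0.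
have -> : (x * y) ^+ k.+1 = x * (y * x) ^+ k * y.
  elim: k => [|k IHk]; first by rewrite expr0 mulr1 expr1.
  by rewrite exprSr IHk exprSr !mulrA.
by rewrite mxtrC mulrA -exprS.
Qed.

(** The square of the dilation is block diagonal with blocks conjugate to [x x^*]
and [x^* x], whose powers have the same trace; [N] is the dimension of the factor
which carries the second copy. *)
Lemma mxtr_hat_emb x k :
  \tr (hat dil (emb x) ^+ k.*2) = 2 * N%:R * \tr ((x^t* * x) ^+ k).
Proof.
have GG := fm_Gsq fm; have G' := fm_Gherm fm.
have h2 : hat dil (emb x) * hat dil (emb x) =
    delta_mx 0 0 *t ((Gm * (x * x^t*) * Gm) *t 1) + delta_mx 1 1 *t ((x^t* * x) *t 1).
  rewrite /hat /dil /emb !adj_tens !adjmx1 e12' G' !tensM !mul1r !mulr1.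
  rewrite mulrDl !mulrDr !tensM GG /e12 !dmul /= !scale0r !scale1r !tens0mx add0r addr0.
  by rewrite !mulrA -[x^t* * Gm * Gm]mulrA GG mulr1 -!mulrA.
rewrite -mul2n exprM expr2 h2.
have -> : (delta_mx 0 0 *t ((Gm * (x * x^t*) * Gm) *t 1)
  + delta_mx 1 1 *t ((x^t* * x) *t 1)) ^+ k
  = delta_mx 0 0 *t (((Gm * (x * x^t*) * Gm) ^+ k) *t 1)
    + delta_mx 1 1 *t (((x^t* * x) ^+ k) *t 1) :> 'M[C]_(2 * (N * N)).
  elim: k => [|k IHk].
    rewrite !expr0 -tensDl !tens11 (_ : _ + _ = 1) ?tens11 //.
    by apply/matrixP => i j; rewrite !mxE; case: (I2 i) => ->; case: (I2 j) => ->;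
      rewrite /= ?addr0 ?add0r.
  rewrite exprS IHk mulrDl !mulrDr !tensM !dmul /= !scale0r !scale1r !tens0mx.
  by rewrite add0r addr0 -!exprS mul1r.
rewrite linearD /= !mxtr_tens mxtrace1.
have tr1 (i : 'I_2) : \tr (delta_mx i i : 'M[C]_2) = 1.
  rewrite /mxtrace (bigD1 i) //= big1 ?addr0; first by rewrite mxE eqxx.
  by move=> k' /negbTE ki; rewrite mxE ki.
rewrite !tr1 !mul1r.
have -> : \tr ((Gm * (x * x^t*) * Gm) ^+ k) = \tr ((x^t* * x) ^+ k).
  by rewrite -mulrA mxtr_XC -mulrA GG mulr1 mxtr_XC.
by ring.
Qed.

Let tr_emb W x : 0 <= \tr (W^t* * emb (x^t* * x) * W).
Proof. by rewrite embM emb_adj !mulrA -adjM -mulrA; apply: mxtr_sqmod_ge0. Qed.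

Let tr_emb_sum W (F : 'I_n -> 'M[C]_N) :
  \tr (W^t* * emb (\sum_j F j) * W) = \sum_j \tr (W^t* * emb (F j) * W).
Proof. by rewrite emb_sum mulr_sumr mulr_suml linear_sum. Qed.

(** The operator inequality [sum_j (E_j E_j^* + E_j^* E_j) <= G] is given through a
factorization of the difference as [L^* L], a form preserved by the embedding. *)
Lemma grad_bounded_emb (c : {set 'I_n} -> C) (G : C) (L : 'M[C]_N) :
  G%:M = L^t* * L + \sum_j (partialD Q c j * (partialD Q c j)^t* +
                            (partialD Q c j)^t* * partialD Q c j) ->
  grad_bounded c G (fun i => emb (Q i)).
Proof.
move=> GE.
have GW W : G * \tr (W^t* * W) = \tr (W^t* * emb (L^t* * L) * W) +
    (\sum_j \tr (W^t* * emb (partialD Q c j * (partialD Q c j)^t*) * W) +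
     \sum_j \tr (W^t* * emb ((partialD Q c j)^t* * partialD Q c j) * W)).
  transitivity (\tr (W^t* * emb G%:M * W)).
    by rewrite -[G%:M]scalemx1 embZ emb1 mxscaleMr mulr1 mxscaleMl linearZ.
  rewrite GE big_split /= !embD !mulrDr !mulrDl !linearD /= -!tr_emb_sum.
  by [].
split=> W; rewrite GW.
  under eq_bigr do rewrite emb_partialD -emb_adj -embM.
  rewrite addrCA lerDl addr_ge0 //; apply: sumr_ge0 => j _; exact: tr_emb.
under eq_bigr do rewrite emb_partialD -emb_adj -embM.
rewrite addrA lerDr addr_ge0 //; apply: sumr_ge0 => j _.
by rewrite -{1}[partialD Q c j]trmxCK.
Qed.

End TensorRealization.

(** * Gaussian bounds for real moments *)

Section RealMoments.
Variables (R : rcfType) (N n : nat).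
Local Notation C := R[i].
Variables (Q : 'I_n -> 'M[C]_N) (Gm : 'M[C]_N).
Hypothesis fm : fermions Q Gm.
Hypothesis N_gt0 : (0 < N)%N.
Variables (c : {set 'I_n} -> C) (G : R) (L : 'M[C]_N).
Hypothesis GE : (G%:C)%C%:M = L^t* * L + \sum_j (partialD Q c j * (partialD Q c j)^t* +
                            (partialD Q c j)^t* * partialD Q c j).

Local Notation e := (dil Gm).
Local Notation rc := (@real_complex R).

(** The unnormalized moment [tr |x|^(2k)]. *)
Definition sqmoment (x : 'M[C]_N) k : R := complex.Re (\tr ((x^t* * x) ^+ k)).

(** The double factorial [(2k-1)!!], which is the Gaussian moment of order [2k]. *)
Definition dfact k : R := \prod_(i < k) (i.*2.+1)%:R.

Let fd := fermion_double_tens fm.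

Lemma sqmomentE x k : \tr ((x^t* * x) ^+ k) = rc (sqmoment x k).
Proof.
have xx : (x^t* * x)^t* = x^t* * x by rewrite adjM trmxCK.
rewrite /sqmoment RRe_real // CrealE; apply/eqP.
by rewrite -mxtr_adj adjmxX xx.
Qed.

Lemma mxtr_hat_sqmoment x k : \tr (hat e (emb x) ^+ k.*2) = rc (2 * N%:R * sqmoment x k).
Proof. by rewrite (mxtr_hat_emb fm) sqmomentE !rmorphM !rmorph_nat. Qed.

Lemma sqmoment_ge0 x k : 0 <= sqmoment x k.
Proof.
have := mxtr_even_ge0 k (hat_herm e (emb x)).
by rewrite mxtr_hat_sqmoment lecR pmulr_rge0 // mulr_gt0 // ltr0n.
Qed.

Lemma sqmoment0 x : sqmoment x 0 = N%:R.
Proof. by rewrite /sqmoment expr0 mxtrace1 -(rmorph_nat rc). Qed.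

Lemma unit_circle (x : R) : 0 < x -> x < 1 ->
  [/\ 0 <= rc x, 0 < rc (Num.sqrt (1 - x ^+ 2)) &
    rc x ^+ 2 + rc (Num.sqrt (1 - x ^+ 2)) ^+ 2 = 1].
Proof.
move=> x0 x1; have x2 : x ^+ 2 < 1 by rewrite expr_lt1 // ltW.
rewrite lecR ltcR ltW // sqrtr_gt0 subr_gt0 x2; split=> //.
rewrite -!rmorphXn /= -rmorphD sqr_sqrtr ?subr_ge0 1?ltW //.
by rewrite addrCA subrr addr0.
Qed.

(** The coefficient of [x^|A|] contributed by [A] to [F(x)] for [Z = H^(2k+1)]. *)
Definition pairing (H : 'M[C]_(2 * (N * N))) k A : R :=
  complex.Re (\tr (hat e (c A *: emb (monomx Q A)) * H ^+ k.*2.+1)).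

Lemma Re_rot_sum (x : R) H k :
  complex.Re (rot_sum (fun i => emb (Q i)) e c (rc x) (H ^+ k.*2.+1)) =
  \sum_(A : {set 'I_n}) pairing H k A * (#|A|%:R * x ^+ #|A|.-1).
Proof.
rewrite /rot_sum raddf_sum; apply: eq_bigr => A _ /=.
rewrite emb_monomx /pairing -(rmorph_nat rc) -rmorphXn -rmorphM /=.
by case: (\tr _) => a b /=; simpc; rewrite mulrC.
Qed.

Lemma Re_le_norm (z : C) : rc (complex.Re z) <= `|z|.
Proof. by apply: le_trans (normc_ge_Re z); rewrite lecR ler_norm. Qed.

(** The weights can be moved inside the dilation because they are real, and then
the sum is the trace of [H * H^(2k+1)]. *)
Lemma sum_pairing (w : {set 'I_n} -> R) k :
  let H := hat e (emb (lincomb Q (fun A => rc (w A) * c A))) in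
  \sum_(A : {set 'I_n}) pairing H k A * w A = 2 * N%:R * sqmoment (lincomb Q (fun A
    => rc (w A) * c A)) k.+1.
Proof.
set x := lincomb Q _ => H; apply: (@complexI R); rewrite -mxtr_hat_sqmoment.
rewrite doubleS exprS -/H.
have hH : H^t* = H by exact: hat_herm.
have hZ : (H ^+ k.*2.+1)^t* = H ^+ k.*2.+1 by rewrite adjmxX hH.
have HE : H = \sum_A rc (w A) *: hat e (c A *: emb (monomx Q A)).
  rewrite /H emb_sum hat_sum; apply: eq_bigr => A _.
  have wR : rc (w A) \is Num.real by apply/complex_realP; exists (w A).
  transitivity (hat e (rc (w A) *: (c A *: emb (monomx Q A)))); last exact: hatZ.
  rewrite (embZ (rc (w A) * c A) (monomx Q A)); congr (hat e _).
  exact: (esym (scalerA (rc (w A)) (c A) (emb (monomx Q A)))).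
rewrite {2}HE mulr_suml linear_sum /= rmorph_sum /=; apply: eq_bigr => A _.
rewrite mxscaleMl linearZ /= rmorphM /= mulrC; congr (_ * _).
rewrite /pairing RRe_real // CrealE; apply/eqP.
by rewrite -mxtr_adj adjM hZ hat_herm mxtrC.
Qed.

(** The mean value theorem on [[0, 1]] for the polynomial [F] turns the bound of
[moment_stein] on [F'] into a bound on [F 1 - F 0 = tr H^(2k+2)]; the constant term
of [F] vanishes because [c] has no component on the empty set. *)
Lemma stein_step k : c finset.set0 = 0 ->
  sqmoment (lincomb Q c) k.+1 <= k.*2.+1%:R * (G * sqmoment (lincomb Q c) k).
Proof.
move=> c0; set X := lincomb Q c; set H := hat e (emb X).
have XE : X = lincomb Q (fun A => rc 1 * c A).
  by apply: eq_bigr => A _; rewrite rmorph1 mul1r.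
pose P : {poly R} := \sum_(A : {set 'I_n}) pairing H k A *: 'X^#|A|.
have Px (x : R) : P.[x] = \sum_(A : {set 'I_n}) pairing H k A * x ^+ #|A|.
  by rewrite /P horner_sum; apply: eq_bigr => A _; rewrite hornerZ hornerXn.
have P'x (x : R) : P^`().[x] = complex.Re (rot_sum (fun i
  => emb (Q i)) e c (rc x) (H ^+ k.*2.+1)).
  rewrite Re_rot_sum /P raddf_sum /= horner_sum; apply: eq_bigr => A _ /=.
  by rewrite derivZ derivXn hornerZ hornerMn hornerXn mulr_natl.
have P1 : P.[1] = 2 * N%:R * sqmoment X k.+1.
  have := sum_pairing (fun=> 1) k; rewrite /= -XE -/H => <-.
  by rewrite Px; apply: eq_bigr => A _; rewrite expr1n.
have P0 : P.[0] = 0.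
  rewrite Px; apply: big1 => A _; rewrite expr0n; case: eqP => [/eqP|_];
    last by rewrite mulr0.
  rewrite cards_eq0 => /eqP ->; rewrite /pairing c0 scale0r hat0 mul0r mxtrace0.
  by rewrite mul0r.
have [x] := poly_mvt P (@ltr01 R); rewrite P1 P0 !subr0 mulr1 inE /= => /andP[x0 x1] PE.
have [c0' s0 cs1] := unit_circle x0 x1.
have := moment_stein fd k c0' s0 cs1 (grad_bounded_emb GE).
rewrite emb_lincomb -/H mxtr_hat_sqmoment => le1.
have NN : 0 < 2 * N%:R :> R by rewrite mulr_gt0 // ltr0n.
rewrite -(ler_pM2l NN) PE P'x -lecR; apply: le_trans (Re_le_norm _) _.
apply: le_trans le1 _; rewrite -(rmorph_nat rc) -!rmorphM /= lecR.
by rewrite le_eqVlt; apply/orP; left; apply/eqP; ring.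
Qed.

Lemma sqmoment_stein k : 0 <= G -> c finset.set0 = 0 ->
  sqmoment (lincomb Q c) k <= dfact k * G ^+ k * N%:R.
Proof.
move=> G0 c0; elim: k => [|k IHk]; first by rewrite sqmoment0 /dfact big_ord0 expr0 !mul1r.
apply: le_trans (stein_step k c0) _.
have -> : dfact k.+1 * G ^+ k.+1 * N%:R = k.*2.+1%:R * (G * (dfact k * G ^+ k * N%:R)).
  by rewrite /dfact big_ord_recr /= exprS; ring.
by rewrite ler_wpM2l ?ler0n // ler_wpM2l.
Qed.

(** The premise on [w] abstracts the integral formula for [|A|^alpha]: a bound [M]
on [s F'(c)] along the quarter circle implies a bound [M * K] on the sum obtained
when [F'] is replaced by the weights [w].  Applied to [moment_rotation] it yields
[m <= a K^(2p) tr S^(2p) + b m] for the moment [m] in question; as [a + b = 1] and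
[a > 0], the last term is absorbed. *)
Lemma sqmoment_transfer (w : {set 'I_n} -> R) (K : R) k : 0 <= G -> 0 < K ->
  (forall (z : {set 'I_n} -> R) (M : R), 0 <= M ->
     (forall x, 0 < x -> x < 1 ->
        (\sum_(A : {set 'I_n}) z A * (#|A|%:R * x ^+ #|A|.-1)) * Num.sqrt (1 - x ^+ 2)
          <= M) ->
     \sum_(A : {set 'I_n}) z A * w A <= M * K) ->
  sqmoment (lincomb Q (fun A => rc (w A) * c A)) k <= dfact k * (K ^+ 2 * G) ^+ k * N%:R.
Proof.
move=> G0 K0 transfer; case: k => [|k]; first by rewrite sqmoment0 /dfact big_ord0 expr0
  !mul1r.
set X := lincomb Q _; set H := hat e (emb X).
have NN : 0 < 2 * N%:R :> R by rewrite mulr_gt0 // ltr0n.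
have bd := grad_bounded_emb GE.
pose S := \sum_j hat e (ferm2 Q Gm j * partialD (fun i => emb (Q i)) c j).
have hS : S^t* = S by rewrite adjmx_sum; apply: eq_bigr => j _; rewrite hat_herm.
have trS j : \tr (S ^+ j.*2) <= rc (dfact j * G ^+ j * (2 * N%:R * N%:R)).
  elim: j => [|j IHj].
    by rewrite expr0 /dfact big_ord0 expr0 !mul1r mxtrace1 !natrM mulrA -!(rmorph_nat rc)
      -!rmorphM.
  apply: le_trans (grad_moment fd j bd) _.
  have -> : dfact j.+1 * G ^+ j.+1 * (2 * N%:R * N%:R)
    = j.*2.+1%:R * (G * (dfact j * G ^+ j * (2 * N%:R * N%:R))).
    by rewrite /dfact big_ord_recr /= exprS; ring.
  rewrite rmorphM rmorph_nat ler_wpM2l ?ler0n // rmorphM ler_wpM2l // lecR //.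
have gH j : GRing.comm (flip Q Gm j) H.
  apply: (comm_hat (fd_gg fd j) (fd_gg' fd j) (fd_ge fd j)).
  rewrite -emb_lincomb; apply: commr_sum => A _.
  rewrite /GRing.comm mxscaleMr mxscaleMl; congr (_ *: _).
  by apply: commr_prod => i _; exact: (fd_gq fd).
have hH : H^t* = H by exact: hat_herm.
have [[a b] /= [a0 b0 ab1 rot]] := moment_rotation fd c k.
have aR : rc (complex.Re a) = a by rewrite RRe_real // ger0_real // ltW.
have bR : rc (complex.Re b) = b by rewrite RRe_real // ger0_real.
set ra := complex.Re a in aR; set rb := complex.Re b in bR.
have ra0 : 0 < ra by rewrite -ltcR aR.
have rb0 : 0 <= rb by rewrite -lecR bR.
have rab : ra + rb = 1 by apply: (@complexI R); rewrite rmorphD /= aR bR.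
pose sS := dfact k.+1 * G ^+ k.+1 * (2 * N%:R * N%:R).
(* The right-hand side of [moment_rotation] with [lam = K]; dividing it by [K]
   compensates the factor which the transfer costs. *)
pose M := ra * (K ^+ k.+1.*2 * sS) + rb * (2 * N%:R * sqmoment X k.+1).
have := transfer (pairing H k) (M / K); rewrite divfK ?gt_eqF //.
have -> := sum_pairing w k.
rewrite -/X => muM.
have M0 : 0 <= M / K.
  have dfact0 : 0 <= dfact k.+1 by apply: prodr_ge0 => i _; rewrite ler0n.
  rewrite divr_ge0 ?(ltW K0) // addr_ge0 // mulr_ge0 ?(ltW ra0) //.
    by rewrite mulr_ge0 ?exprn_ge0 ?(ltW K0) // !mulr_ge0 ?exprn_ge0 ?ler0n.
  by rewrite mulr_ge0 ?sqmoment_ge0 // ltW.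
have {muM} : 2 * N%:R * sqmoment X k.+1 <= M.
  apply: (muM M0) => x x0 x1; have [c0' s0 cs1] := unit_circle x0 x1.
  rewrite ler_pdivlMr // -Re_rot_sum -lecR.
  have lam0 : 0 <= rc K by rewrite lecR ltW.
  have := rot H _ _ _ hH gH lam0 c0' (ltW s0) cs1.
  rewrite [X in _ + b * X](mxtr_hat_sqmoment X k.+1) => le1.
  set rr := rot_sum _ _ _ _ _ in le1 *.
  have -> : complex.Re rr * Num.sqrt (1 - x ^+ 2) * K = K * Num.sqrt (1
    - x ^+ 2) * complex.Re rr by ring.
  apply: (@le_trans _ _ (rc K * rc (Num.sqrt (1 - x ^+ 2)) * `|rr|)).
    by rewrite !rmorphM /=; apply: ler_wpM2l (Re_le_norm _); rewrite mulr_ge0 // ltW.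
  apply: le_trans le1 _.
  have -> : rc M = a * (rc K ^+ k.+1.*2 * rc sS) + b * rc (2 * N%:R * sqmoment X k.+1).
    have rcM : {morph rc : u v / u * v} by exact: rmorphM.
    by rewrite /M rmorphD /= (rcM ra) (rcM rb) (rcM (K ^+ _)) aR bR -rmorphXn.
  rewrite lerD2r; apply: ler_wpM2l; first exact: ltW.
  by apply: ler_wpM2l; [rewrite exprn_ge0|exact: trS].
rewrite /M -{1}[2 * N%:R * sqmoment _ _]mul1r -{1}rab mulrDl lerD2r ler_pM2l // => le1.
rewrite -(ler_pM2l NN); apply: le_trans le1 _.
rewrite le_eqVlt; apply/orP; left; apply/eqP.
by rewrite /sS -mul2n exprM !exprMn; ring.
Qed.

End RealMoments.

(** * Fermions as tensor products of Pauli matrices *)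

Section TensorProducts.
Variable R : realType.
Local Notation C := R[i].
Implicit Types (A B : nat -> 'M[C]_2).

Lemma tensprod_recM A B k :
  tensprod_rec A k * tensprod_rec B k = tensprod_rec (fun i => A i * B i) k.
Proof. by elim: k A B => [|k IHk] A B //=; rewrite tensM IHk. Qed.

Lemma tensprod_rec_adj A k : (tensprod_rec A k)^t* = tensprod_rec (fun i => (A i)^t*) k.
Proof. by elim: k A => [|k IHk] A //=; rewrite adj_tens IHk. Qed.

Lemma tensprod_rec1 k : tensprod_rec (fun=> 1 : 'M[C]_2) k = 1.
Proof. by elim: k => [|k IHk] //=; rewrite IHk tens11. Qed.

Lemma tensprod_recZ (s : nat -> C) A B k : (forall i, (i < k.+1)%N -> A i = s i *: B i) ->
  tensprod_rec A k = (\prod_(i < k.+1) s i) *: tensprod_rec B k.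
Proof.
elim: k s A B => [|k IHk] s A B AB; first by rewrite /= big_ord1 AB.
rewrite big_ord_recl /= AB // (IHk (fun i => s i.+1) _ (fun i => B i.+1));
  last by move=> i ik; apply: AB.
by rewrite tensZl tensZr scalerA.
Qed.

Lemma tensprodM A B n :
  tensprod A n * tensprod B n = tensprod (fun i => A i * B i) n.
Proof. by case: n => [|n]; [rewrite /= mulr1 | exact: tensprod_recM]. Qed.

Lemma tensprod_adj A n : (tensprod A n)^t* = tensprod (fun i => (A i)^t*) n.
Proof. by case: n => [|n]; [exact: adjmx1 | exact: tensprod_rec_adj]. Qed.

Lemma tensprod1 n : tensprod (fun=> 1 : 'M[C]_2) n = 1.
Proof. by case: n => [|n]; [|exact: tensprod_rec1]. Qed.

Lemma tensprodZ (s : nat -> C) A B n : (forall i, (i < n)%N -> A i = s i *: B i) ->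
  tensprod A n = (\prod_(i < n) s i) *: tensprod B n.
Proof. by case: n => [|n]; [rewrite big_ord0 scale1r | exact: tensprod_recZ]. Qed.

Lemma eq_tensprod A B n : (forall i, (i < n)%N -> A i = B i) -> tensprod A n = tensprod B n.
Proof. by move=> AB; rewrite (@tensprodZ (fun=> 1) A B) ?big1 ?scale1r // => i /AB ->;
  rewrite scale1r. Qed.

Lemma tensprod_flip A B n (j : 'I_n) : A j = - B j ->
  (forall i, (i < n)%N -> i != j -> A i = B i) -> tensprod A n = - tensprod B n.
Proof.
move=> Aj AB; rewrite (@tensprodZ (fun i => if i == j then -1 else 1) A B); last first.
  by move=> i il; case: eqP => [->|/eqP ij]; rewrite ?scaleN1r ?scale1r // AB.
rewrite (bigD1 j) //= eqxx big1 ?mulr1 ?scaleN1r // => i /negbTE ij.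
by rewrite -val_eqE in ij; rewrite ij.
Qed.

Lemma pauliU_herm : (pauliU R)^t* = pauliU R.
Proof.
apply/matrixP => i j; rewrite !mxE [j == i]eq_sym; case: eqP => [->|_];
  last by rewrite conjC0.
by rewrite rmorphXn rmorphN1.
Qed.

Lemma pauliQ_herm : (pauliQ R)^t* = pauliQ R.
Proof. by apply/matrixP => i j; rewrite !mxE conjC_nat eq_sym. Qed.

Let I2 (P : 'I_2 -> Prop) : P 0 -> P 1 -> forall i, P i.
Proof.
by move=> P0 P1 [[|[|//]] h]; [rewrite (_ : Ordinal h = 0) //|rewrite (_ : Ordinal h = 1)
  //]; apply: val_inj.
Qed.

Lemma pauliU_sq : pauliU R * pauliU R = 1.
Proof.
apply/matrixP; apply: I2; apply: I2; rewrite !mxE !big_ord_recl big_ord0 !mxE /=;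
by rewrite ?expr0 ?expr1 ?mulr0 ?mul0r ?addr0 ?add0r ?mulr1 ?mulrNN ?mulr1.
Qed.

Lemma pauliQ_sq : pauliQ R * pauliQ R = 1.
Proof.
apply/matrixP; apply: I2; apply: I2; rewrite !mxE !big_ord_recl big_ord0 !mxE /=;
by rewrite ?mulr0 ?mul0r ?addr0 ?add0r ?mulr1.
Qed.

Lemma pauliUQ : pauliU R * pauliQ R = - (pauliQ R * pauliU R).
Proof.
apply/matrixP; apply: I2; apply: I2; rewrite !mxE !big_ord_recl !big_ord0 !mxE /=;
by rewrite ?expr0 ?expr1 ?mulr0 ?mul0r ?addr0 ?add0r ?mulr1 ?mul1r ?oppr0 ?opprK.
Qed.

Definition parity n : 'M[C]_(2 ^ n) := tensprod (fun=> pauliU R) n.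

Lemma fermions_fermion n : fermions (@fermion R n) (parity n).
Proof.
have one2 : (1%:M : 'M[C]_2) = 1 by [].
split.
- move=> i; rewrite tensprod_adj; apply: eq_tensprod => k _.
  by do ?case: ifP => _; rewrite ?pauliU_herm ?pauliQ_herm ?adjmx1.
- move=> i; rewrite tensprodM -(tensprod1 n); apply: eq_tensprod => k _.
  by do ?case: ifP => _; rewrite ?pauliU_sq ?pauliQ_sq ?one2 ?mulr1.
- have lt (i j : 'I_n) : (i < j)%N -> fermion R i * fermion R j =
  - (fermion R j * fermion R i) :> 'M[C]_(2 ^ n).
    move=> ij; rewrite !tensprodM; apply: (@tensprod_flip _ _ n i).
      by rewrite ltnn eqxx ij pauliUQ opprK.
    move=> k _ ki; rewrite (negbTE ki); case: ltnP => [ki'|ik].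
      by rewrite (ltn_trans ki' ij).
    by case: ifP => _; [|case: ifP => _]; rewrite one2 ?mulr1 ?mul1r.
  move=> i j; rewrite -val_eqE neq_ltn => /orP[/lt //|/lt ->]; by rewrite opprK.
- by rewrite tensprod_adj; apply: eq_tensprod => k _; rewrite pauliU_herm.
- by rewrite tensprodM -(tensprod1 n); apply: eq_tensprod => k _; rewrite pauliU_sq.
- move=> i; rewrite !tensprodM; apply: (@tensprod_flip _ _ n i).
    by rewrite ltnn eqxx pauliUQ.
  move=> k _ ki; rewrite (negbTE ki); case: ifP => _ //.
  by rewrite one2 mulr1 mul1r.
Qed.

End TensorProducts.

(** * Expansion in monomials and the CAR algebra *)

Section Expansion.
Variables (C : numClosedFieldType) (N n : nat) (Q : 'I_n -> 'M[C]_N) (Gm : 'M[C]_N).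
Hypothesis fm : fermions Q Gm.

Lemma ordmemD1 (A : {set 'I_n}) j s1 s2 : ordmem A = s1 ++ j :: s2 ->
  ordmem (A :\ j) = s1 ++ s2.
Proof.
move=> AE; have := ordmem_uniq A; rewrite AE cat_uniq /= => /and3P[_ /norP[jNs1 _]
  /andP[jNs2 _]].
have -> : ordmem (A :\ j) = [seq i <- ordmem A | i != j].
  by rewrite -filter_predI; apply: eq_filter => i /=; rewrite !inE.
rewrite AE filter_cat /= eqxx /=.
by congr (_ ++ _); apply/all_filterP/allP => i is_;
  [apply: contraNneq jNs1 => <-|apply: contraNneq jNs2 => <-].
Qed.

(** Multiplication by a fermion permutes the monomials up to sign, which makes
their span an algebra. *)
Lemma mul_monomx_toggle A j : exists a : C,
  Q j * monomx Q A = a *: monomx Q (if j \in A then A :\ j else j |: A).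
Proof.
have toggle (B : {set 'I_n}) : j \in B -> exists a : C,
  Q j * monomx Q B = a *: monomx Q (B :\ j) /\ a * a = 1.
  move=> jB; have jE : j \in ordmem B by rewrite mem_ordmem.
  have [s1 [s2 BE]] : exists s1 s2, ordmem B = s1 ++ j :: s2.
    by case/splitPr: jE => s1 s2; exists s1, s2.
  exists ((-1) ^+ size s1); split; last by rewrite -expr2 sqrr_sign.
  have := ordmem_uniq B; rewrite BE cat_uniq /= => /and3P[_ /norP[jNs1 _] _].
  rewrite !monomx_word (ordmemD1 BE) BE /wordmx !big_cat big_cons /= mulrA
    -/(wordmx Q s1) anti_wordmx.
    by rewrite mxscaleMl -mulrA [Q j * (Q j * _)]mulrA (fm_sq fm) mul1r.
  by move=> i is1; apply: (fm_anti fm); apply: contraNneq jNs1 => ->.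
case: ifP => jA; first by have [a [aE _]] := toggle A jA; exists a.
have [a [aE aa]] := toggle (j |: A) (setU11 _ _).
exists a; rewrite -[monomx Q A]scale1r -aa -scalerA -{1}(setU1K (negbT jA)) -aE.
by rewrite mxscaleMr mulrA (fm_sq fm) mul1r.
Qed.

Lemma flip_monomx A j : Q j * Gm * monomx Q A =
  (-1) ^+ (j \in A) *: (monomx Q A * (Q j * Gm)).
Proof.
have cw s : j \notin s -> GRing.comm (Q j * Gm) (wordmx Q s).
  by move=> jNs; apply: comm_wordmx => i is_; apply: (flip_comm fm);
    apply: contraNneq jNs => <-.
case: (boolP (j \in A)) => jA; last first.
  by rewrite scale1r monomx_word cw // mem_ordmem.
have [s1 [s2 [jNs1 jNs2 yE]]] := monomx_split C N jA.
have key (x w1 w2 : 'M[C]_N) : x * Q j = - (Q j * x) -> GRing.comm x w1 -> GRing.comm x w2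
  ->
    x * (w1 * Q j * w2) = - (w1 * Q j * w2 * x).
  move=> xq xw1 xw2; rewrite !mulrA xw1 -[w1 * x * _]mulrA xq mulrN !mulNr.
  by rewrite -!mulrA xw2.
by rewrite yE expr1 scaleN1r key ?(flip_anti fm) //; exact: cw.
Qed.

Lemma monomx_unitary A : (monomx Q A)^t* * monomx Q A = 1.
Proof.
rewrite monomx_word; elim: (ordmem A) => [|i s IHs].
  by rewrite /wordmx big_nil adjmx1 mulr1.
rewrite /wordmx big_cons -/(wordmx Q s) adjM (fm_herm fm) mulrA -[_ * Q i * Q i]mulrA.
by rewrite (fm_sq fm) mulr1.
Qed.

(** If [j] lies in exactly one of [A] and [B], the product [q_B^* q_A] anticommutes
with the unitary [Q j * Gm]. *)
Lemma mxtr_monomx_ortho A B : A != B -> \tr ((monomx Q B)^t* * monomx Q A) = 0.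
Proof.
move=> AB; have [j jAB] : exists j, (j \in A) != (j \in B).
  apply/existsP; apply: contraNT AB => /existsPn AB; apply/eqP/setP => j.
  by apply/eqP; rewrite -[_ == _]negbK; exact: AB.
have [uu uu'] := flip_unitary fm j.
apply: (@mxtr_anti0 C N (Q j * Gm)) => //.
have uB' : Q j * Gm * (monomx Q B)^t* = (-1) ^+ (j \in B) *: ((monomx Q B)^t* * (Q j * Gm)).
  have := flip_monomx B j; move: (Q j * Gm) (monomx Q B) uu uu' => x y xx xx' xy.
  have := congr1 (fun w : 'M[C]_N => w^t*) xy; rewrite adjM adjmxZ adjM rmorphXn
    /= rmorphN1 => yx.
  rewrite -[LHS]mulr1 -xx' mulrA -[x * _ * _]mulrA yx mxscaleMr mxscaleMl mulrA xx mul1r.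
  by [].
rewrite mulrA uB' mxscaleMl -mulrA flip_monomx mxscaleMr scalerA !mulrA -signr_addb.
by move: jAB; case: (j \in A); case: (j \in B) => //= _; rewrite expr1 scaleN1r.
Qed.

Lemma mxtr_lincomb c B : \tr ((monomx Q B)^t* * lincomb Q c) = c B * N%:R.
Proof.
rewrite mulr_sumr linear_sum /= (bigD1 B) //= big1 ?addr0.
  by rewrite mxscaleMr linearZ /= monomx_unitary mxtrace1.
by move=> A AB; rewrite mxscaleMr linearZ /= mxtr_monomx_ortho // mulr0.
Qed.

Lemma mxtr_lincomb0 c : \tr (lincomb Q c) = c finset.set0 * N%:R.
Proof. by rewrite -mxtr_lincomb /monomx big_set0 adjmx1 mul1r. Qed.

(** The sum of the [Q_j D_j] is the number operator, with eigenvalue [|A|] on the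
monomial of [A]. *)
Lemma partialD_eq0 c A : (0 < N)%N -> (forall j, partialD Q c j = 0) ->
  A != finset.set0 -> c A = 0.
Proof.
move=> N0 Dc A0.
have : \sum_j Q j * partialD Q c j = lincomb Q (fun A => #|A|%:R * c A).
  transitivity (\sum_j \sum_(A : {set 'I_n} | j \in A) c A *: monomx Q A).
    apply: eq_bigr => j _; rewrite mulr_sumr; apply: eq_bigr => B jB.
    by rewrite mxscaleMr mulrA (fm_sq fm) mul1r.
  rewrite (exchange_big_dep xpredT) //=; apply: eq_bigr => B _.
  by rewrite sumr_const -scaler_nat scalerA.
rewrite big1 => [/(congr1 (fun w : 'M[C]_N => \tr ((monomx Q A)^t* * w)))|j _]; last first.
  by rewrite Dc mulr0.
rewrite mxtr_lincomb mulr0 mxtrace0 => /esym/eqP; rewrite !mulf_eq0 !pnatr_eq0 cards_eq0.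
by rewrite (negbTE A0) /= -[N == 0%N]negbK -lt0n N0 orbF => /eqP.
Qed.

End Expansion.

Section CARAlgebra.
Variables (R : realType) (n : nat).
Local Notation C := R[i].
Local Notation q := (@fermion R n).
Local Notation V := <<fermion_basis R n>>%VS.

Let fm := fermions_fermion R n.

Lemma fermion_basisE (A : {set 'I_n}) : (fermion_basis R n)`_(enum_rank A) = monomx q A.
Proof. by rewrite -tnth_nth tnth_mktuple enum_rankK. Qed.

Lemma monomx_CAR (A : {set 'I_n}) : monomx q A \in V.
Proof. by rewrite -fermion_basisE memv_span // mem_nth // size_tuple ltn_ord. Qed.

Lemma CAR_expand T : T \in V ->
  T = lincomb q (fun A => coord (fermion_basis R n) (enum_rank A) T).
Proof.
move=> /coord_span {1}->; rewrite (reindex (@enum_rank {set 'I_n})) /=; last first.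
  by apply: onW_bij; exact: enum_rank_bij.
by apply: eq_bigr => A _; rewrite fermion_basisE.
Qed.

Lemma fermion_mul_CAR j x : x \in V -> q j * x \in V.
Proof.
move=> /CAR_expand ->; rewrite mulr_sumr; apply: memv_suml => A _.
by rewrite mxscaleMr; have [a ->] := mul_monomx_toggle fm A j; rewrite !memvZ ?monomx_CAR.
Qed.

Lemma word_mul_CAR s x : x \in V -> wordmx q s * x \in V.
Proof.
move=> xV; elim: s => [|i s IHs]; first by rewrite /wordmx big_nil mul1r.
by rewrite /wordmx big_cons -mulrA fermion_mul_CAR.
Qed.

(** The span of the monomials contains the generators and is itself a
star-subalgebra, so it contains the smallest one. *)
Lemma CAR_span T : CAR R n T -> T \in V.
Proof.
have oneV : (1 : 'M[C]_(2 ^ n)) \in V.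
  by have := monomx_CAR finset.set0; rewrite /monomx big_set0.
move=> CT; apply: (CT [set x | x \in V]%classic); split=> [|_ [j _ <-]]; last first.
  by rewrite /= -[fermion R j]mulr1 fermion_mul_CAR.
split=> //= [a x y xV yV|x y xV yV|x xV].
- by rewrite memvD // memvZ.
- rewrite (CAR_expand xV) mulmxE mulr_suml; apply: memv_suml => A _.
  by rewrite mxscaleMl memvZ // monomx_word word_mul_CAR.
- rewrite (CAR_expand xV) adjmx_sum; apply: memv_suml => A _.
  rewrite adjmxZ memvZ // monomx_word adjmx_prod.
  rewrite (eq_bigr q) => [|i _]; last by rewrite (fm_herm fm).
  by rewrite -[\prod_(i <- _) _]mulr1; apply: word_mul_CAR.
Qed.

Variable T : 'M[C]_(2 ^ n).
Hypothesis TV : T \in V.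

Definition car_coef (A : {set 'I_n}) : C := coord (fermion_basis R n) (enum_rank A) T.

Lemma car_coefE : T = lincomb q car_coef.
Proof. exact: CAR_expand. Qed.

Lemma CAR_DE j : CAR_D j T = partialD q car_coef j.
Proof.
rewrite /CAR_D /CAR_linear /partialD [RHS]big_mkcond; apply: eq_bigr => A _.
by case: ifP => _; rewrite ?scaler0.
Qed.

Definition npow_weight (alpha : R) (A : {set 'I_n}) : R :=
  if A == finset.set0 then 0 else #|A|%:R `^ alpha.

Lemma CAR_NpowE alpha : CAR_Npow alpha T = lincomb q (fun A
  => (npow_weight alpha A)%:C%C * car_coef A).
Proof.
rewrite /CAR_Npow /CAR_linear; apply: eq_bigr => A _; rewrite /npow_weight.
case: ifP => _; first by rewrite scaler0 mul0r scale0r.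
by rewrite scalerA mulrC.
Qed.

Lemma ntraceE : ntrace T = car_coef finset.set0.
Proof.
have N0 : (2 ^ n)%:R != 0 :> C by rewrite pnatr_eq0 expn_eq0.
by rewrite /ntrace {1}car_coefE (mxtr_lincomb0 fm) mulfK.
Qed.

Definition car_coef0 (A : {set 'I_n}) : C := if A == finset.set0 then 0 else car_coef A.

Lemma centerE : T - (ntrace T)%:M = lincomb q car_coef0.
Proof.
rewrite ntraceE {1}car_coefE /lincomb (bigD1 finset.set0) //= [RHS](bigD1 finset.set0) //=.
rewrite {1}/car_coef0 eqxx scale0r add0r {1}/monomx big_set0 -scalemx1 addrAC subrr add0r.
by apply: eq_bigr => A /negbTE A0; rewrite /car_coef0 A0.
Qed.

Lemma partialD_coef0 j : partialD q car_coef0 j = partialD q car_coef j.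
Proof.
apply: eq_bigr => A jA; rewrite /car_coef0; case: eqP => // A0.
by rewrite A0 inE in jA.
Qed.

Lemma grad_eq0 : CAR_grad T = 0 -> forall A, A != finset.set0 -> car_coef A = 0.
Proof.
move=> DT A A0; apply: (partialD_eq0 fm _ _ A0); first by rewrite expn_gt0.
by move=> j; rewrite -CAR_DE; move/ffunP/(_ j): DT; rewrite !ffunE.
Qed.

End CARAlgebra.

(** * Absolute value, operator norm and spectral measure *)

Section SpectralCalculus.
Variable R : realType.
Local Notation C := R[i].
Local Notation rc := (@real_complex R).

Lemma mxcalcE m (f : C -> C) (A : 'M[C]_m) :
  mxcalc f A = (spectralmx A)^t* * diag_mx (map_mx f (spectral_diag A)) * spectralmx A.
Proof. by rewrite /mxcalc invmx_unitary // spectral_unitarymx. Qed.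

(** Positivity tested by traces, the form in which it is used; the rank one test
matrices give back the usual notion. *)
Definition psdmx m (A : 'M[C]_m) := A^t* = A /\ forall W : 'M[C]_m, 0 <= \tr (W^t* * A * W).

Lemma psd_diag_ge0 m (A : 'M[C]_m) i : psdmx A -> 0 <= spectral_diag A 0 i.
Proof.
move=> [/hermitian_spectral[UU UU' dR AE] psd].
have := psd ((spectralmx A)^t* * delta_mx i i); rewrite {2}AE adjM trmxCK !mulrA.
rewrite -[_ * _ * (spectralmx A)^t*]mulrA UU' mulr1.
rewrite -[_ * _ * (spectralmx A)^t*]mulrA UU' mulr1 => /le_trans; apply.
rewrite /mxtrace (bigD1 i) //= big1 ?addr0.
  rewrite -mulmxE mxE (bigD1 i) //= big1 ?addr0; last first.
    by move=> j ji; rewrite [delta_mx _ _ _ _]mxE (negbTE ji) mulr0.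
  rewrite [delta_mx _ _ _ _]mxE !eqxx mulr1 mxE (bigD1 i) //= big1 ?addr0; last first.
    by move=> j ji; rewrite !mxE (negbTE ji) conjC0 mul0r.
  by rewrite !mxE !eqxx conjC1 mul1r mulr1n.
by move=> j ji; rewrite -mulmxE mxE big1 // => k _;
  rewrite [delta_mx _ _ _ _]mxE (negbTE ji) andbF mulr0.
Qed.

Lemma mxsqrt_herm m (A : 'M[C]_m) : psdmx A -> (mxsqrt A)^t* = mxsqrt A.
Proof.
move=> psd; have DE : (diag_mx (map_mx sqrtC (spectral_diag A)))^t* =
    diag_mx (map_mx sqrtC (spectral_diag A)).
  apply/matrixP => i j; rewrite !mxE eq_sym; case: eqP => [->|_]; last by rewrite conjC0.
  by rewrite !mulr1n geC0_conj // sqrtC_ge0 psd_diag_ge0.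
by rewrite /mxsqrt mxcalcE !adjM trmxCK DE mulrA.
Qed.

Lemma mxsqrt_sq m (A : 'M[C]_m) : psdmx A -> mxsqrt A * mxsqrt A = A.
Proof.
move=> psd; have [_ UU' _ AE] := hermitian_spectral psd.1.
rewrite /mxsqrt mxcalcE [RHS]AE; move: (spectralmx A) UU' => U UU' {AE}.
have <- : diag_mx (map_mx sqrtC (spectral_diag A)) * diag_mx (map_mx sqrtC (spectral_diag
  A)) =
    diag_mx (spectral_diag A).
  rewrite -mulmxE mulmx_diag; congr diag_mx; apply/rowP => i; rewrite !mxE.
  by rewrite -expr2 sqrtCK.
by rewrite !mulrA -(mulrA _ U) UU' mulr1.
Qed.

Lemma l2normE m (x : 'cV[C]_m) : rc (l2norm x ^+ 2) = \tr (x^t* *m x).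
Proof.
rewrite /l2norm sqr_sqrtr; last by apply: sumr_ge0 => i _; exact: sqr_ge0.
rewrite mxtr_sqmod big_ord1 rmorph_sum; apply: eq_bigr => i _ /=.
by rewrite rmorphXn /= normc_def; case: (x i 0).
Qed.

Lemma l2norm_ge0 m (x : 'cV[C]_m) : 0 <= l2norm x.
Proof. exact: sqrtr_ge0. Qed.

Lemma l2norm_sqrt m (A : 'M[C]_m) (x : 'cV[C]_m) : psdmx A ->
  rc (l2norm (mxsqrt A *m x) ^+ 2) =
  \sum_i spectral_diag A 0 i * `|(spectralmx A *m x) i 0| ^+ 2.
Proof.
move=> psd; have [UU UU' _ AE] := hermitian_spectral psd.1.
rewrite l2normE adjmxM mxsqrt_herm // mulmxA -[_ *m _ *m mxsqrt A]mulmxA mulmxE.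
rewrite mxsqrt_sq // {1}AE -!mulmxE !mulmxA -adjmxM.
transitivity (\tr ((spectralmx A *m x)^t* *m diag_mx (spectral_diag A) *m (spectralmx A *m
  x))).
  by rewrite !mulmxA.
move: (spectralmx A *m x) => y; rewrite trace_mx11 mxE; apply: eq_bigr => i _.
rewrite mxE (bigD1 i) //= big1 ?addr0; last first.
  by move=> j ji; rewrite [diag_mx _ _ _]mxE (negbTE ji) mulr0n mulr0.
by rewrite !mxE eqxx mulr1n normCK; ring.
Qed.

(** An eigenvalue of [A] is the squared norm of the image of its unit eigenvector
under the square root of [A]. *)
Lemma spectral_diag_opnorm m (A : 'M[C]_m) i : psdmx A ->
  spectral_diag A 0 i <= rc (opnorm (mxsqrt A) ^+ 2).
Proof.
move=> psd; have [UU UU' _ AE] := hermitian_spectral psd.1.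
pose x : 'cV[C]_m := (spectralmx A)^t* *m delta_mx i 0.
have Ux : spectralmx A *m x = delta_mx i 0.
  by rewrite /x mulmxA (UU' : _ *m _ = 1%:M) mul1mx.
have dE : rc (l2norm (mxsqrt A *m x) ^+ 2) = spectral_diag A 0 i.
  rewrite l2norm_sqrt // Ux (bigD1 i) //= big1 ?addr0.
    by rewrite mxE !eqxx normr1 expr1n mulr1.
  by move=> j ji; rewrite mxE (negbTE ji) normr0 expr0n mulr0.
have Unorm (y : 'cV[C]_m) : rc (l2norm y ^+ 2) = \sum_j `|(spectralmx A *m y) j 0| ^+ 2.
  rewrite l2normE; transitivity (\tr ((spectralmx A *m y)^t* *m (spectralmx A *m y))).
    by rewrite adjmxM mulmxA -(mulmxA _ _ (spectralmx A)) (UU : _ *m _ = 1%:M) mulmx1.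
  by rewrite mxtr_sqmod big_ord1.
have x1 : l2norm x = 1.
  apply/eqP; rewrite -[_ == _](@eqrXn2 _ 2) ?l2norm_ge0 //; apply/eqP/(@complexI R).
  rewrite Unorm Ux (bigD1 i) //= big1 ?addr0 ?expr1n.
    by rewrite mxE !eqxx normr1 expr1n.
  by move=> j ji; rewrite mxE (negbTE ji) normr0 expr0n.
(* The supremum bounds its set only once that set is known to be bounded; here
   [l^2 <= tr A] gives the crude bound [l <= 1 + tr A]. *)
have ub : has_ubound [set l2norm (mxsqrt A *m x) | x in [set x : 'cV[C]_m | l2norm x
  = 1]]%classic.
  pose b := \sum_j complex.Re (spectral_diag A 0 j).
  have dj j : rc (complex.Re (spectral_diag A 0 j)) = spectral_diag A 0 j.
    by rewrite RRe_real // ger0_real // psd_diag_ge0.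
  exists (1 + b) => _ [y /= y1 <-].
  have b0 : 0 <= b by apply: sumr_ge0 => j _; rewrite -lecR dj psd_diag_ge0.
  have : l2norm (mxsqrt A *m y) ^+ 2 <= b.
    rewrite -lecR l2norm_sqrt // /b rmorph_sum; apply: ler_sum => j _ /=.
    rewrite dj ler_piMr ?psd_diag_ge0 //.
    have U1 : 1 = \sum_j `|(spectralmx A *m y) j 0| ^+ 2 :> C.
      by rewrite -Unorm y1 expr1n rmorph1.
    rewrite [X in _ <= X]U1.
    rewrite (bigD1 j) //= lerDl; apply: sumr_ge0 => k _; by rewrite exprn_ge0.
  move: (l2norm_ge0 (mxsqrt A *m y)); set l := l2norm _ => l0 lb.
  rewrite leNgt; apply/negP => bl.
  have : (1 + b) * (1 + b) <= l ^+ 2.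
    by rewrite expr2; apply: ler_pM; rewrite ?addr_ge0 // ltW.
  move=> /le_trans/(_ lb); rewrite leNgt => /negP; apply.
  rewrite mulrDl mul1r mulrDr mulr1; apply: ltr_wpDr; first by rewrite addr_ge0 // mulr_ge0.
  by rewrite ltrDr.
rewrite -dE lecR ler_pXn2r ?nnegrE ?l2norm_ge0 //.
  by apply: ub_le_sup => //; exists x.
apply: le_trans (l2norm_ge0 (mxsqrt A *m x)) _.
by apply: ub_le_sup => //; exists x.
Qed.

(** The inequality [A <= g] between Hermitian matrices, as a factorization of
[g - A], obtained from the square roots of [g - d_i] for the eigenvalues [d_i]. *)
Lemma opnorm_decomp m (A : 'M[C]_m) : psdmx A -> exists L : 'M[C]_m,
  (rc (opnorm (mxsqrt A) ^+ 2))%:M = L^t* * L + A.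
Proof.
move=> psd; have [UU UU' _ AE] := hermitian_spectral psd.1.
set g := rc _; pose d := spectral_diag A; pose U := spectralmx A.
pose D : 'M[C]_m := diag_mx (map_mx (fun z => sqrtC (g - z)) d).
have gd i : 0 <= g - d 0 i by rewrite subr_ge0 spectral_diag_opnorm.
exists (D * U); rewrite adjM [X in _ + X]AE -/U -/d.
have -> : U^t* * D^t* * (D * U) = U^t* * diag_mx (map_mx (fun z => g - z) d) * U.
  rewrite !mulrA -[U^t* * _ * D]mulrA; congr (_ * _ * _).
  have -> : D^t* = D.
    apply/matrixP => i j; rewrite !mxE eq_sym; case: eqP => [->|_]; last by rewrite conjC0.
    by rewrite !mulr1n geC0_conj // sqrtC_ge0.
  by rewrite -mulmxE mulmx_diag; congr diag_mx; apply/rowP => i; rewrite !mxE -expr2 sqrtCK.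
rewrite -mulrDl -mulrDr -[diag_mx _ + _]raddfD /=.
have -> : map_mx (fun z => g - z) d + d = const_mx g.
  by apply/rowP => i; rewrite !mxE subrK.
by rewrite diag_const_mx -scalemx1 mxscaleMr mulr1 mxscaleMl UU.
Qed.

Lemma psd_sqmod m (X : 'M[C]_m) : psdmx (X^t* * X).
Proof.
split; first by rewrite adjM trmxCK.
by move=> W; rewrite mulrA -adjM -mulrA; apply: mxtr_sqmod_ge0.
Qed.

Lemma psdD m (A B : 'M[C]_m) : psdmx A -> psdmx B -> psdmx (A + B).
Proof.
move=> [hA A0] [hB B0]; split; first by rewrite adjmxD hA hB.
by move=> W; rewrite mulrDr mulrDl linearD /=; apply: addr_ge0.
Qed.

Lemma psd_sum m n (F : 'I_n -> 'M[C]_m) : (forall i, psdmx (F i)) -> psdmx (\sum_i F i).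
Proof.
move=> F0; apply: (big_ind (@psdmx m)) => [|A B|i _]; [|exact: psdD|exact: F0].
by split; [rewrite trmx0 map_mx0|move=> W; rewrite mulr0 mul0r mxtrace0].
Qed.

Lemma mxtr_calc m (f : C -> C) (A : 'M[C]_m) : \tr (mxcalc f A)
  = \sum_i f (spectral_diag A 0 i).
Proof.
have UU' : spectralmx A * (spectralmx A)^t* = 1 by apply/unitarymxP;
  exact: spectral_unitarymx.
rewrite mxcalcE mxtrC mulrA UU' mul1r mxtrace_diag.
by apply: eq_bigr => i _; rewrite mxE.
Qed.

(** Markov's inequality for the counting measure on the eigenvalues of [|X|]:
[t^(2k)] is at most [h^(2k)] for each eigenvalue [h >= t], and the sum of all
[h^(2k)] is [tr (X^* X)^k]. *)
Lemma spectral_markov m (X : 'M[C]_m) (t : R) : 0 < t ->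
  exists2 p : R, \tr (spectral_measure (mxabs X) `[t, +oo[%classic) = rc p &
   [/\ 0 <= p, p <= m%:R & forall k, t ^+ k.*2 * p <= sqmoment X k].
Proof.
move=> t0; have psd := psd_sqmod X; have hH := mxsqrt_herm psd.
have [UU UU' hR HE] := hermitian_spectral hH; have H2 := mxsqrt_sq psd.
set H := mxsqrt _ in hH UU UU' hR HE H2.
have hE i : rc (complex.Re (spectral_diag H 0 i)) = spectral_diag H 0 i by rewrite RRe_real.
set h := fun i => complex.Re (spectral_diag H 0 i).
exists (\sum_i \1_(`[t, +oo[%classic) (h i)).
  by rewrite /spectral_measure mxtr_calc rmorph_sum.
split.
- by apply: sumr_ge0 => i _; rewrite indicE ler0n.
- rewrite -[m in X in _ <= X]card_ord -sumr_const; apply: ler_sum => i _.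
  by rewrite indicE; case: (_ \in _); rewrite ?ler01.
move=> k; rewrite -lecR -sqmomentE -mulmxE -[X^t* *m X]H2.
have -> : \tr ((H * H) ^+ k) = rc (\sum_i h i ^+ k.*2).
  rewrite -expr2 -exprM mul2n {1}HE.
  have := @exprX_conj C m ((spectralmx H)^t*) (diag_mx (spectral_diag H)) k.*2.
  rewrite trmxCK => -> //; rewrite diag_mxX mxtrC mulrA UU' mul1r mxtrace_diag rmorph_sum.
  by apply: eq_bigr => i _; rewrite mxE -hE rmorphXn.
rewrite lecR mulr_sumr; apply: ler_sum => i _.
rewrite indicE; case: (boolP (_ \in _)) => [|_]; last first.
  by rewrite mulr0 -mul2n exprM exprn_ge0 // sqr_ge0.
rewrite inE /= in_itv /= andbT mulr1 => ti.
by apply: lerXn2r => //; rewrite nnegrE ?ltW // (lt_le_trans t0).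
Qed.

End SpectralCalculus.

(** * The substitution relating the Gamma integral to log cos *)

Section GammaSubstitution.
Import numFieldNormedType.Exports.
Local Open Scope classical_set_scope.
Variable R : realType.
Local Notation mu := (@lebesgue_measure R).
Variable alpha : R.

(** The integrand of [K_alpha]. *)
Definition wcos (theta : R) : R := (- ln (cos theta)) `^ (- alpha).

(** The integrand of [Gamma (1 - alpha)]. *)
Definition gammaf (u : R) : R := u `^ (- alpha) * expR (- u).

Lemma cos_itv (x : R) : 0 < x -> x < pi / 2 -> [/\ 0 < cos x, cos x < 1 & 0 < sin x].
Proof.
move=> x0 xp; have c0 : 0 < cos x.
  by apply: cos_gt0_pihalf; rewrite xp (lt_trans _ x0) // oppr_lt0 divr_gt0 // pi_gt0.
split=> //; last by apply: sin_gt0_pihalf; rewrite x0.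
rewrite -[X in _ < X]cos0 ltr_cos ?in_itv /= ?lexx ?pi_ge0 // ltW //=.
by rewrite (le_trans (ltW xp)) // ler_pdivrMr // ler_peMr ?pi_ge0 // ler1n.
Qed.

(** The change of variable; the index is [d + 1] so that the exponent [d] of the
cosine in its Jacobian avoids a predecessor. *)
Definition scaled_lncos d (theta : R) : R := - (d.+1%:R * ln (cos theta)).

Lemma is_derive_scaled_lncos d (x : R) : 0 < x -> x < pi / 2 ->
  is_derive x (1 : R) (scaled_lncos d) (d.+1%:R * (sin x / cos x)).
Proof.
move=> x0 xp; have [c0 _ _] := cos_itv x0 xp.
have h1 : is_derive x (1 : R) (@ln R \o @cos R) ((cos x)^-1 * (- sin x)) :=
  is_derive1_comp (is_derive1_ln c0) (is_derive_cos x).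
have h2 := is_deriveN (is_deriveZ d.+1%:R h1).
apply: is_derive_eq h2 _.
by rewrite /GRing.scale /= mulrN mulrN opprK [sin x / _]mulrC.
Qed.

Lemma derivable_gammaf (u : R) : 0 < u -> derivable gammaf u 1.
Proof.
move=> u0; have h1 := is_derive1_powR (- alpha) u0.
have h2 : is_derive u (1 : R) (fun x : R => expR (- x)) (expR (- u) * -1).
  exact: (@is_derive1_comp R expR (@GRing.opp R)).
by have [] := is_deriveM h1 h2.
Qed.

Lemma derivable_continuous1 (f : R -> R) x : derivable f x 1 -> {for x, continuous f}.
Proof. by move=> /derivable1_diffP/differentiable_continuous. Qed.

Lemma lncos_gt0 (x : R) : 0 < x -> x < pi / 2 -> 0 < - ln (cos x).
Proof.
move=> x0 xp; have [c0 c1 _] := cos_itv x0 xp.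
by rewrite oppr_gt0 -ln1 ltr_ln ?posrE.
Qed.

(** Stated on a compact interval of angles inside the open quarter circle, where
all the functions involved are continuous; the end points, where the integrand may
be singular, are reached by a limit afterwards. *)
Lemma gammaf_substitution d (a b : R) : 0 < a -> a <= b -> b < pi / 2 ->
  (\int[mu]_(u in `[scaled_lncos d a, scaled_lncos d b]) (gammaf u)%:E =
   \int[mu]_(x in `[a, b])
     (d.+1%:R `^ (- alpha) * (wcos x * (d.+1%:R * cos x ^+ d * sin x)))%:E)%E.
Proof.
move=> a0 ab bp.
have inab x : a <= x -> x <= b -> 0 < x /\ x < pi / 2.
  by move=> ax xb; rewrite (lt_le_trans a0 ax) (le_lt_trans xb bp).
have dF x : a <= x -> x <= b -> is_derive x (1 : R) (scaled_lncos d) (d.+1%:R * (sin x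
  / cos x)).
  by move=> ax xb; have [] := inab x ax xb; exact: is_derive_scaled_lncos.
have F'E x : 0 < x -> x < pi / 2 -> (scaled_lncos d)^`() x = d.+1%:R * (sin x / cos x).
  by move=> x0 xp; rewrite derive1E; have := is_derive_scaled_lncos d x0 xp => -[].
have cF' x : 0 < x -> x < pi / 2 -> {for x, continuous (scaled_lncos d)^`()}.
  move=> x0 xp; have [c0 _ _] := cos_itv x0 xp.
  have ct : {for x, continuous (fun y : R => d.+1%:R * (sin y / cos y))}.
    apply: continuousM; first exact: cvg_cst.
    by apply: continuousM; [exact: continuous_sin|apply: continuousV;
      [rewrite gt_eqF|exact: continuous_cos]].
  have nE : {near x, (fun y : R => d.+1%:R * (sin y / cos y)) =1 (scaled_lncos d)^`()}.
    near=> y; rewrite F'E //; near: y; [exact: lt_nbhsr|exact: lt_nbhsl].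
  rewrite /prop_for /continuous_at F'E //.
  apply: cvg_trans ct; apply: near_eq_cvg; exact: nE.
have cF x : 0 < x -> x < pi / 2 -> {for x, continuous (scaled_lncos d)}.
  by move=> x0 xp; apply: derivable_continuous1; have [] := is_derive_scaled_lncos d x0 xp.
have [ap b0] : a < pi / 2 /\ 0 < b by rewrite (le_lt_trans ab bp) (lt_le_trans a0 ab).
rewrite (integration_by_substitution_increasing ab).
- apply: eq_integral => x; rewrite inE /= in_itv /= => /andP[ax xb].
  have [x0 xp] := inab x ax xb; have [c0 _ _] := cos_itv x0 xp.
  transitivity (gammaf (scaled_lncos d x) * derive1 (scaled_lncos d) x)%:E => //.
  rewrite F'E // /gammaf /wcos /scaled_lncos opprK -mulrN powRM ?ler0n ?(ltW (lncos_gt0 _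
    _)) //.
  rewrite expRM_natl lnK ?posrE // exprS; congr (_%:E).
  by field; rewrite gt_eqF.
- move=> x y; rewrite !in_itv /= => /andP[ax xb] /andP[ay yb] xy.
  have [x0 xp] := inab x ax xb; have [y0 yp] := inab y ay yb.
  have [cx _ _] := cos_itv x0 xp; have [cy _ _] := cos_itv y0 yp.
  rewrite /scaled_lncos ltrN2 ltr_pM2l ?ltr0n // ltr_ln ?posrE //.
  have pi2 : pi / 2 <= pi :> R by rewrite ler_pdivrMr // ler_peMr ?pi_ge0 // ler1n.
  by rewrite ltr_cos // in_itv /= ltW //= ltW // (lt_le_trans _ pi2).
- by move=> x; rewrite in_itv /= => /andP[/ltW ax /ltW xb]; have [] := inab x ax xb;
  exact: cF'.
- by apply/cvg_ex; exists ((scaled_lncos d)^`() a); apply: cvg_at_right_filter; exact: cF'.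
- by apply/cvg_ex; exists ((scaled_lncos d)^`() b); apply: cvg_at_left_filter; exact: cF'.
- split.
  + by move=> x; rewrite in_itv /= => /andP[/ltW ax /ltW xb]; have [] := dF x ax xb.
  + by apply: cvg_at_right_filter; exact: cF.
  + by apply: cvg_at_left_filter; exact: cF.
- apply: continuous_in_subspaceT => u; rewrite inE /= in_itv /= => /andP[Fau _].
  apply: derivable_continuous1; apply: derivable_gammaf; apply: lt_le_trans Fau.
  by rewrite /scaled_lncos -mulrN mulr_gt0 ?ltr0n // lncos_gt0.
Unshelve. all: by end_near.
Qed.

End GammaSubstitution.

(** * From derivatives to fractional powers *)

Section FractionalTransfer.
Import numFieldNormedType.Exports.
Local Open Scope classical_set_scope.
Variable R : realType.
Local Notation mu := (@lebesgue_measure R).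
Variable alpha : R.
Local Notation w := (wcos alpha).
Local Notation gam := (gammaf alpha).

(** The angles at which [- log cos] takes the values [1 / (N + 1)] and [N + 1].
With this choice the images of the angle intervals under the change of variable are
explicit and exhaust the half line, for every scaling factor. *)
Definition lo_angle (N : nat) : R := acos (expR (- N.+1%:R^-1)).
Definition hi_angle (N : nat) : R := acos (expR (- N.+1%:R)).

Lemma acos_exp (r : R) : 0 < r ->
  [/\ 0 < acos (expR (- r)), acos (expR (- r)) < pi / 2 & - ln (cos (acos (expR (- r))))
    = r].
Proof.
move=> r0; have e1 : expR (- r) < 1 by rewrite -expR0 ltr_expR oppr_lt0.
have e0 := expR_gt0 (- r).
have e11 : -1 <= expR (- r) <= 1 by rewrite (ltW e1) andbT (le_trans _ (ltW e0)) // lerN10.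
have cE : cos (acos (expR (- r))) = expR (- r) by rewrite acosK // in_itv.
split; last by rewrite cE expRK opprK.
  by rewrite acos_gt0 // e1 andbT; case/andP: e11.
have pi2 : 0 <= (pi / 2 : R) <= pi.
  by rewrite divr_ge0 ?pi_ge0 //= ler_pdivrMr // ler_peMr ?pi_ge0 // ler1n.
by rewrite -ltr_cos ?in_itv //= ?acos_ge0 ?acos_lepi // cos_pihalf cE.
Qed.

Lemma lo_hi_angle N : [/\ 0 < lo_angle N, lo_angle N <= hi_angle N & hi_angle N < pi / 2].
Proof.
have r0 : 0 < N.+1%:R^-1 :> R by rewrite invr_gt0 ltr0n.
have r1 : 0 < N.+1%:R :> R by rewrite ltr0n.
have [a0 ap aE] := acos_exp r0; have [b0 bp bE] := acos_exp r1.
split=> //; rewrite leNgt; apply/negP => ba.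
have [ca _ _] := cos_itv a0 ap; have [cb _ _] := cos_itv b0 bp.
have pi2 : pi / 2 <= pi :> R by rewrite ler_pdivrMr // ler_peMr ?pi_ge0 // ler1n.
have : cos (lo_angle N) < cos (hi_angle N).
  by rewrite ltr_cos // in_itv /= ltW //= ltW // (lt_le_trans _ pi2).
rewrite -ltr_ln ?posrE // -ltrN2 -[X in X < _]/(- ln (cos (acos _))).
rewrite bE aE ltNge => /negP; apply.
by apply: (@le_trans _ _ 1); rewrite ?invf_le1 ?ler1n.
Qed.

Lemma scaled_lo N d : scaled_lncos d (lo_angle N) = d.+1%:R / N.+1%:R.
Proof.
have r0 : 0 < N.+1%:R^-1 :> R by rewrite invr_gt0 ltr0n.
by rewrite /scaled_lncos -mulrN /lo_angle; have [_ _ ->] := acos_exp r0.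
Qed.

Lemma scaled_hi N d : scaled_lncos d (hi_angle N) = d.+1%:R * N.+1%:R.
Proof.
have r0 : 0 < N.+1%:R :> R by rewrite ltr0n.
by rewrite /scaled_lncos -mulrN /hi_angle; have [_ _ ->] := acos_exp r0.
Qed.

Lemma measurable_gammaf (D : set (measurableTypeR R)) : measurable_fun D gam.
Proof.
apply: measurable_funTS; apply: measurable_funM; first exact: measurable_powR.
by apply: measurableT_comp => //; exact: measurable_expR.
Qed.

Lemma gammaf_ge0 u : 0 <= gam u.
Proof. by rewrite mulr_ge0 ?powR_ge0 ?expR_ge0. Qed.

(** Monotone convergence along the intervals [[d'/(N+1), d' (N+1)]], [d' = d + 1]. *)
Lemma gammaf_cvg d :
  (\int[mu]_(u in `[scaled_lncos d (lo_angle N), scaled_lncos d (hi_angle N)]) (gam u)%:E)%E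
    @[N --> \oo] --> (\int[mu]_(u in `]0%R, +oo[) (gam u)%:E)%E.
Proof.
pose J N : set (measurableTypeR R) := `[d.+1%:R / N.+1%:R, d.+1%:R * N.+1%:R].
rewrite (_ : (fun N => _) = (fun N => \int[mu]_(u in J N) (gam u)%:E)%E); last first.
  by apply/funext => N; rewrite scaled_lo scaled_hi.
have -> : `]0%R, +oo[%classic = \bigcup_N J N.
  apply/seteqP; split => [u|u [N _]]; rewrite /J /= !in_itv /=.
    rewrite andbT => u0.
    pose c : R := d.+1%:R; have c0 : 0 < c by rewrite ltr0n.
    pose N := maxn (Num.truncn (c / u)) (Num.truncn (u / c)).
    exists N => //=; rewrite in_itv /= -/c.
    have N1 : c / u <= N.+1%:R.
      by apply: ltW; apply: lt_le_trans (truncnS_gt _) _; rewrite ler_nat ltnS leq_maxl.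
    have N2 : u / c <= N.+1%:R.
      by apply: ltW; apply: lt_le_trans (truncnS_gt _) _; rewrite ler_nat ltnS leq_maxr.
    rewrite ler_pdivrMr ?ltr0n // mulrC -ler_pdivrMr // N1 /=.
    by rewrite mulrC -ler_pdivrMr.
  by move=> /andP[lo _]; rewrite andbT (lt_le_trans _ lo) // divr_gt0 ?ltr0n.
have := @ge0_nondecreasing_set_cvg_integral _ (measurableTypeR R) R J (EFin \o gam) mu;
  apply.
- move=> N N' NN'; apply/subsetPset => u; rewrite /J /= !in_itv /= => /andP[lo hi].
  apply/andP; split.
    by apply: le_trans lo; rewrite ler_pM2l ?ltr0n // lef_pV2 ?posrE ?ltr0n // ler_nat ltnS.
  by apply: le_trans hi _; rewrite ler_pM2l ?ltr0n // ler_nat ltnS.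
- by move=> N; exact: measurable_itv.
- by move=> N; apply/measurable_EFinP; exact: measurable_gammaf.
- by move=> N u _ /=; rewrite lee_fin gammaf_ge0.
Qed.

Lemma wcos_ge0 x : 0 <= w x. Proof. exact: powR_ge0. Qed.

Lemma wcos_continuous x : 0 < x -> x < pi / 2 -> {for x, continuous w}.
Proof.
move=> x0 xp; apply: derivable_continuous1.
have h1 := is_derive1_powR (- alpha) (lncos_gt0 x0 xp).
have [c0 _ _] := cos_itv x0 xp.
have h2 := is_deriveN (is_derive1_comp (is_derive1_ln c0) (is_derive_cos x)).
by have [] := @is_derive1_comp R (fun y => y `^ (- alpha)) (- (@ln R \o @cos R)) x _ _ h1
  h2.
Qed.

Definition weighted k (x : R) : R := w x * (k%:R * cos x ^+ k.-1 * sin x).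

Lemma weighted_continuous k x : 0 < x -> x < pi / 2 -> {for x, continuous (weighted k)}.
Proof.
move=> x0 xp; apply: continuousM; first exact: wcos_continuous.
apply: continuousM; last exact: continuous_sin.
apply: continuousM; first exact: cvg_cst.
apply: (@continuous_comp _ _ _ (@cos R) (fun y => y ^+ k.-1)); first exact: continuous_cos.
exact: exprn_continuous.
Qed.

Lemma itv_continuous_integrable (f : R -> R) a b : 0 < a -> b < pi / 2 ->
  (forall x, 0 < x -> x < pi / 2 -> {for x, continuous f}) ->
  mu.-integrable `[a, b] (EFin \o f).
Proof.
move=> a0 bp fc; apply: continuous_compact_integrable; first exact: segment_compact.
apply: continuous_in_subspaceT => x; rewrite inE /= in_itv /= => /andP[ax xb].
by apply: fc; [exact: lt_le_trans ax | exact: le_lt_trans bp].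
Qed.

Lemma Rintegral_sum (I : Type) (s : seq I) (f : I -> R -> R) (D : set R) :
  measurable D -> (forall i, mu.-integrable D (EFin \o f i)) ->
  mu.-integrable D (EFin \o (fun x => \sum_(i <- s) f i x)) /\
  \int[mu]_(x in D) (\sum_(i <- s) f i x) = \sum_(i <- s) \int[mu]_(x in D) f i x.
Proof.
move=> mD fi; elim: s => [|i s [IH1 IH2]].
  have -> : (fun x => \sum_(i <- [::]) f i x) = (fun=> 0) by apply/funext => x;
    rewrite big_nil.
  by split; [exact: integrable0 | rewrite big_nil Rintegral_cst // mul0r].
have -> : (fun x => \sum_(j <- i :: s) f j x) = (fun x => f i x + \sum_(j <- s) f j x).
  by apply/funext => x; rewrite big_cons.
split; last by rewrite RintegralD // IH2 big_cons.
rewrite (_ : _ \o _ = (fun x => (EFin \o f i) x + (EFin \o (fun x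
  => (\sum_(j <- s) f j x)%R)) x)%E) //.
exact: integrableD.
Qed.

(** The truncated Gamma integral seen through the change of variable of index [d];
its limit does not depend on [d]. *)
Definition gam_trunc d N : R :=
  fine (\int[mu]_(u in `[scaled_lncos d (lo_angle N),
    scaled_lncos d (hi_angle N)]) (gam u)%:E)%E.

Lemma weighted_integral d N :
  \int[mu]_(x in `[lo_angle N, hi_angle N]) weighted d.+1 x
    = d.+1%:R `^ alpha * gam_trunc d N.
Proof.
have [a0 ab bp] := lo_hi_angle N.
rewrite /gam_trunc (gammaf_substitution _ _ a0 ab bp).
rewrite -[fine _]/(\int[mu]_(x in `[lo_angle N, hi_angle N]) (d.+1%:R `^ (- alpha) *
  weighted d.+1 x)).
rewrite RintegralZl //; last by apply: itv_continuous_integrable => // x;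
  exact: weighted_continuous.
by rewrite mulrA powRN divff ?mul1r // gt_eqF // powR_gt0 // ltr0n.
Qed.

Lemma measurable_wcos (D : set (measurableTypeR R)) : measurable_fun D w.
Proof.
apply: measurable_funTS.
have m1 : measurable_fun [set: measurableTypeR R] (@ln R \o @cos R).
  apply: measurableT_comp; first exact: measurable_ln.
  by apply: continuous_measurable_fun; exact: continuous_cos.
have m2 : measurable_fun [set: measurableTypeR R] (-%R \o (@ln R \o @cos R)).
  by apply: measurableT_comp m1; exact: oppr_measurable.
have m3 : measurable_fun [set: measurableTypeR R]
    ((fun y : R => y `^ (- alpha)) \o (-%R \o (@ln R \o @cos R))).
  by apply: measurableT_comp m2; exact: measurable_powR.
exact: m3.
Qed.

(** Integrate the pointwise bound at [x = cos theta] against [wcos] over the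
truncated interval, where the sum and the integral can be exchanged. *)
Lemma weighted_sum_le (I : finType) (deg : I -> nat) (z : I -> R) (M : R) N :
  0 < alpha -> 0 <= M ->
  (forall x, 0 < x -> x < 1 ->
     (\sum_i z i * ((deg i)%:R * x ^+ (deg i).-1)) * Num.sqrt (1 - x ^+ 2) <= M) ->
  (\int[mu]_(x in `]0%R, (pi / 2)%R[) (w x)%:E)%E \is a fin_num ->
  \sum_i z i * ((deg i)%:R `^ alpha * gam_trunc (deg i).-1 N) <=
    M * \int[mu]_(x in `]0, pi / 2[) w x.
Proof.
move=> alpha0 M0 le_M WIfin; have [a0 ab bp] := lo_hi_angle N.
set a := lo_angle N in a0 ab *; set b := hi_angle N in ab bp *.
have wi k : mu.-integrable `[a, b] (EFin \o weighted k).
  by apply: itv_continuous_integrable a0 bp _ => x; exact: weighted_continuous.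
have wi0 : mu.-integrable `[a, b] (EFin \o w).
  by apply: itv_continuous_integrable a0 bp _ => x; exact: wcos_continuous.
have zwi i : mu.-integrable `[a, b] (EFin \o (fun x => z i * weighted (deg i) x)).
  rewrite (_ : _ \o _ = (fun x => (z i)%:E * (EFin \o weighted (deg i)) x)%E) //.
  exact: integrableZl.
have [Si SE] := Rintegral_sum (index_enum I) (measurable_itv _) zwi.
have -> : \sum_i z i * ((deg i)%:R `^ alpha * gam_trunc (deg i).-1 N) =
   \int[mu]_(x in `[a, b]) (\sum_i z i * weighted (deg i) x).
  rewrite SE; apply: eq_bigr => i _; rewrite RintegralZl //; congr (_ * _).
  case: (deg i) => [|d]; last by rewrite weighted_integral.
  rewrite powR0 ?gt_eqF // mul0r; under eq_Rintegral do rewrite /weighted !mul0r mulr0.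
  by rewrite Rintegral_cst // mul0r.
apply: (@le_trans _ _ (\int[mu]_(x in `[a, b]) (M * w x))).
  apply: le_Rintegral => //.
    rewrite (_ : _ \o _ = (fun x => M%:E * (EFin \o w) x)%E) //.
    exact: integrableZl.
  move=> x /=; rewrite in_itv /= => /andP[ax xb].
  have x0 := lt_le_trans a0 ax; have xp := le_lt_trans xb bp.
  have [c0 c1 s0] := cos_itv x0 xp.
  have := le_M _ c0 c1; have -> : Num.sqrt (1 - cos x ^+ 2) = sin x.
    by rewrite -sin2cos2 sqrtr_sqr ger0_norm // ltW.
  move=> leM; rewrite [M * _]mulrC.
  have -> : \sum_i z i * weighted (deg i) x =
      w x * (\sum_i z i * ((deg i)%:R * cos x ^+ (deg i).-1) * sin x).
    by rewrite mulr_sumr; apply: eq_bigr => i _; rewrite /weighted; ring.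
  by rewrite -mulr_suml; apply: ler_wpM2l => //; exact: wcos_ge0.
rewrite RintegralZl //; apply: ler_wpM2l => //; apply: fine_le => //.
  exact: integrable_fin_num.
apply: ge0_subset_integral => //.
- by apply/measurable_EFinP; exact: measurable_wcos.
- by move=> x _; rewrite lee_fin wcos_ge0.
- move=> x /=; rewrite !in_itv /= => /andP[ax xb].
  by rewrite (lt_le_trans a0 ax) (le_lt_trans xb bp).
Qed.

Lemma gam_trunc_cvg d : (\int[mu]_(u in `]0%R, +oo[) (gam u)%:E)%E \is a fin_num ->
  gam_trunc d N @[N --> \oo] --> \int[mu]_(u in `]0, +oo[) gam u.
Proof. by move=> GIfin; apply: fine_cvg; rewrite fineK //; exact: gammaf_cvg. Qed.

Lemma fin_num_fine_neq0 (x : \bar R) : fine x != 0 -> x \is a fin_num.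
Proof. by case: x => [r||] //=; rewrite eqxx. Qed.

(** The limit of [weighted_sum_le], divided by [Gamma (1 - alpha)].  An integral
that diverges has the value 0, so positivity of [K_alpha] ensures that both
integrals in its definition are finite. *)
Lemma fractional_transfer (I : finType) (deg : I -> nat) (z : I -> R) (M : R) :
  0 < alpha -> 0 < Kconst alpha -> 0 <= M ->
  (forall x, 0 < x -> x < 1 ->
     (\sum_i z i * ((deg i)%:R * x ^+ (deg i).-1)) * Num.sqrt (1 - x ^+ 2) <= M) ->
  \sum_i z i * (deg i)%:R `^ alpha <= M * Kconst alpha.
Proof.
move=> alpha0 K0 M0 le_M.
have KE : Kconst alpha = (\int[mu]_(u in `]0, +oo[) gam u)^-1 * \int[mu]_(x in `]0,
  pi / 2[) w x.
  have -> : \int[mu]_(u in `]0, +oo[) gam u = Gamma (1 - alpha) by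
    apply: eq_Rintegral => u _; rewrite addrAC subrr add0r.
  by [].
have GI0 : 0 <= \int[mu]_(u in `]0, +oo[) gam u by apply: Rintegral_ge0 => u _;
  exact: gammaf_ge0.
have GIN0 : \int[mu]_(u in `]0, +oo[) gam u != 0.
  by apply: contraTneq K0 => GI0'; rewrite KE GI0' invr0 mul0r ltxx.
have WIN0 : \int[mu]_(x in `]0, pi / 2[) w x != 0.
  by apply: contraTneq K0 => WI0'; rewrite KE WI0' mulr0 ltxx.
have trunc_le N := weighted_sum_le N alpha0 M0 le_M (fin_num_fine_neq0 WIN0).
have gcvg d := gam_trunc_cvg d (fin_num_fine_neq0 GIN0).
move: (\int[mu]_(u in `]0, +oo[) gam u) (\int[mu]_(x in `]0, pi / 2[) w x)
  KE GI0 GIN0 {WIN0} trunc_le gcvg => GI WI KE GI0 GIN0 trunc_le gcvg.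
have GI_gt0 : 0 < GI by rewrite lt_neqAle eq_sym GIN0.
have Scvg : \sum_i z i * ((deg i)%:R `^ alpha * gam_trunc (deg i).-1 N) @[N --> \oo] -->
    \sum_i z i * ((deg i)%:R `^ alpha * GI).
  apply: (cvg_big (op := +%R)) => [|i _]; first exact: add_continuous.
  apply: cvgM; first exact: cvg_cst.
  by apply: cvgM; [exact: cvg_cst | exact: gcvg].
have : \sum_i z i * ((deg i)%:R `^ alpha * GI) <= M * WI.
  rewrite -(cvg_lim _ Scvg) //; apply: limr_le; first by apply/cvg_ex; eexists; exact: Scvg.
  by apply: nearW.
rewrite KE mulrCA [GI^-1 * _]mulrC ler_pdivlMr // mulr_suml => le1.
apply: le_trans le1; rewrite le_eqVlt; apply/orP; left; apply/eqP.
by apply: eq_bigr => i _; rewrite mulrA.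
Qed.

End FractionalTransfer.

(** * From Gaussian moments to Gaussian tails *)

Section TailBound.
Import numFieldNormedType.Exports.
Local Open Scope classical_set_scope.
Variable R : realType.

(** From [sin x <= x] at [x = pi / 4], where [sin x ^ 2 = 1 / 2]. *)
Lemma pi_sqr_ge8 : 8 <= (pi : R) ^+ 2.
Proof.
pose x : R := pi / 4; have x0 : 0 < x by rewrite divr_gt0 // pi_gt0.
have [c _] : exists2 c, c \in `]0, x[%R & sin x - sin 0 = cos c * (x - 0).
  by apply: MVT => //; exact/continuous_subspaceT/continuous_sin.
rewrite sin0 !subr0 => sinE.
have sx : sin x <= x by rewrite sinE ger_pMl // cos_le1.
have pp : x *+ 2 = pi / 2 by rewrite /x; field.
have s2 : sin x ^+ 2 = 2^-1.
  have := cos_pihalf R; rewrite -pp cos_mulr2n cos2sin2 => E.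
  by apply/eqP; rewrite -subr_eq0; apply/eqP; apply: (@mulfI _ 2) => //;
    rewrite mulr0 -[RHS]oppr0 -[in RHS]E; field.
have s0 : 0 <= sin x by rewrite ltW // sin_gt0_pihalf // x0 -pp mulr2n ltrDl.
have : sin x ^+ 2 <= x ^+ 2 by rewrite ler_pXn2r // nnegrE // ltW.
rewrite s2 /x expr_div_n ler_pdivlMr ?exprn_gt0 //.
have -> : 2^-1 * 4 ^+ 2 = 8 :> R by field.
by [].
Qed.

Lemma dfactE k : (k.*2)`!%:R = dfact R k * 2 ^+ k * k`!%:R.
Proof.
elim: k => [|k IHk]; first by rewrite /dfact big_ord0 !mul1r.
rewrite doubleS !factS !natrM IHk /dfact big_ord_recr /= exprS.
have -> : k.*2.+2%:R = 2 * k.+1%:R :> R by rewrite -natrM mul2n.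
by ring.
Qed.

Lemma cosh_partial_sum (y : R) n :
  series (exp_coeff y) n + series (exp_coeff (- y)) n =
  2 * \sum_(k < uphalf n) y ^+ k.*2 / (k.*2)`!%:R.
Proof.
elim: n => [|n IHn]; first by rewrite /series /= !big_geq // big_ord0 addr0 mulr0.
rewrite !seriesSr addrACA IHn /exp_coeff /= exprNn.
have [n_odd|n_even] := boolP (odd n).
  rewrite -signr_odd n_odd expr1 mulN1r mulNr subrr addr0; congr (2 * _).
  by rewrite uphalf_half n_odd add1n.
have nE : n = (n./2).*2 by rewrite -[LHS]odd_double_half (negbTE n_even).
rewrite -signr_odd (negbTE n_even) expr0 mul1r uphalf_half (negbTE n_even) add0n.
by rewrite big_ord_recr /= -nE; ring.
Qed.

Lemma exp_partial_sum (u : R) n : 0 <= u -> \sum_(k < n) u ^+ k / k`!%:R <= expR u.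
Proof.
move=> u0; have nd : nondecreasing_seq (series (exp_coeff u)).
  by apply/nondecreasing_seqP => k; rewrite seriesSr lerDl exp_coeff_ge0.
have := nondecreasing_cvgn_le nd (is_cvg_series_exp_coeff u) n.
by rewrite /expR {1}/series /= big_mkord.
Qed.

(** With [u = t^2 / (2s)] and [(2k)! = (2k-1)!! 2^k k!], the moment inequality
reads [p (2u)^(2k) / (2k)! <= u^k / k!].  Summing over [k] gives
[p cosh (2u) <= exp u], and [cosh (2u)] is at least half of [exp (2u)]. *)
Lemma subgaussian_tail (p t s : R) : 0 < t -> 0 < s -> 0 <= p ->
  (forall k, t ^+ k.*2 * p <= dfact R k * s ^+ k) ->
  p <= 2 * expR (- (t ^+ 2 / (2 * s))).
Proof.
move=> t0 s0 p0 mom; pose u := t ^+ 2 / (2 * s).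
have u0 : 0 < u by rewrite divr_gt0 ?exprn_gt0 ?mulr_gt0.
have dbl k (x : R) : x ^+ k.*2 = (x ^+ k) ^+ 2 by rewrite -muln2 exprM.
have t2 k : (t ^+ 2) ^+ k = (t ^+ k) ^+ 2 by rewrite -!exprM mulnC.
have term k : p * ((2 * u) ^+ k.*2 / (k.*2)`!%:R) <= u ^+ k / k`!%:R.
  have uE : u ^+ k / k`!%:R = dfact R k * s ^+ k * (t ^+ k.*2 / s ^+ k.*2 / (k.*2)`!%:R).
    have d0 : dfact R k != 0.
      by rewrite prodf_seq_neq0; apply/allP => i _; rewrite pnatr_eq0.
    rewrite dfactE !dbl /u expr_div_n t2 (exprMn k 2 s).
    move: (t ^+ k) (dfact R k) d0 => tk dk d0; field.
    by rewrite d0 !expf_neq0 ?gt_eqF //= pnatr_eq0 -lt0n fact_gt0.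
  have -> : p * ((2 * u) ^+ k.*2 / (k.*2)`!%:R) = t ^+ k.*2 * p * (t ^+ k.*2 / s ^+ k.*2
    / (k.*2)`!%:R).
    have -> : 2 * u = t ^+ 2 / s by rewrite /u; field; rewrite gt_eqF.
    rewrite !dbl expr_div_n t2; field.
    by rewrite pnatr_eq0 -lt0n fact_gt0 expf_neq0 // gt_eqF.
  by rewrite uE ler_wpM2r // !divr_ge0 ?exprn_ge0 ?ler0n // ltW.
have bnd n : p * (series (exp_coeff (2 * u)) n + series (exp_coeff (- (2 * u))) n)
  <= 2 * expR u.
  rewrite cosh_partial_sum mulrCA ler_pM2l // mulr_sumr.
  apply: le_trans (exp_partial_sum (uphalf n) (ltW u0)).
  by apply: ler_sum => k _; exact: term.
have cvgS : (fun n => p * (series (exp_coeff (2 * u)) n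
  + series (exp_coeff (- (2 * u))) n)) @ \oo -->
    p * (expR (2 * u) + expR (- (2 * u))).
  apply: cvgM; first exact: cvg_cst.
  by apply: cvgD; rewrite /expR; exact: is_cvg_series_exp_coeff.
have : p * (expR (2 * u) + expR (- (2 * u))) <= 2 * expR u.
  rewrite -(cvg_lim _ cvgS) //; apply: limr_le; first by apply/cvg_ex; eexists; exact: cvgS.
  by apply: nearW.
rewrite -/u => le1; rewrite expRN ler_pdivlMr ?expR_gt0 //.
rewrite -(ler_pM2r (expR_gt0 u)); apply: le_trans le1.
have uu : u + u = 2 * u by ring.
by rewrite -mulrA -expRD uu mulrDr lerDl mulr_ge0 // expR_ge0.
Qed.

End TailBound.

(** * Deviation inequalities in the CAR algebra *)

Lemma exponent_compare (R : realFieldType) (a g P : R) : 0 <= a -> 0 <= g -> 8 <= P ->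
  4 * a / (P * g) <= a / (2 * g).
Proof.
move=> a0 g0 P8; have P0 : 0 < P by apply: lt_le_trans P8.
have -> : 4 * a / (P * g) = a / g * (4 / P) by rewrite invfM; ring.
have -> : a / (2 * g) = a / g * 2^-1 by rewrite invfM; ring.
rewrite ler_wpM2l ?divr_ge0 // ler_pdivrMr // mulrC ler_pdivlMr //.
by rewrite -natrM.
Qed.

Section Deviation.
Variables (R : realType) (n : nat).
Local Notation C := R[i].
Local Notation rc := (@real_complex R).
Local Notation q := (@fermion R n).
Local Notation N := (2 ^ n)%N.

Let fm := fermions_fermion R n.

Let N_gt0 : (0 < N)%N. Proof. by rewrite expn_gt0. Qed.

Let NR_gt0 : 0 < N%:R :> R. Proof. by rewrite ltr0n. Qed.

Lemma ntrace_spectral (X : 'M[C]_N) (t : R) : 0 < t ->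
  exists2 p : R, ntrace (spectral_measure (mxabs X) `[t, +oo[%classic) = rc p &
    [/\ 0 <= p, p <= 1 & forall k, t ^+ k.*2 * p <= sqmoment X k / N%:R].
Proof.
move=> t0; have [p pE [p0 pN mom]] := spectral_markov X t0.
exists (p / N%:R); first by rewrite /ntrace pE -(rmorph_nat rc) -fmorph_div.
split; first by rewrite divr_ge0 // ltW.
  by rewrite ler_pdivrMr // mul1r.
by move=> k; rewrite mulrA ler_pM2r ?invr_gt0.
Qed.

Lemma ntrace_spectral0 (t : R) : 0 < t ->
  ntrace (spectral_measure (mxabs (0 : 'M[C]_N)) `[t, +oo[%classic) = 0.
Proof.
move=> t0; have [p -> [p0 _ /(_ 1%N)]] := ntrace_spectral 0 t0.
rewrite /sqmoment mulr0 expr1 mxtrace0 mul0r pmulr_rle0 ?exprn_gt0 // => p0'.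
by have -> : p = 0 by apply/eqP; rewrite eq_le p0 p0'.
Qed.

(** For [s = 0] the right-hand side is 2, because a division by 0 yields 0, and a
normalized trace of a projection is at most 1. *)
Lemma ntrace_subgaussian (X : 'M[C]_N) (t s : R) : 0 < t -> 0 <= s ->
  (forall k, 0 < s -> sqmoment X k <= dfact R k * s ^+ k * N%:R) ->
  ntrace (spectral_measure (mxabs X) `[t, +oo[%classic) <= rc (2 * expR (- (t ^+ 2
    / (2 * s)))).
Proof.
move=> t0 s0 mom; have [p -> [p0 p1 momp]] := ntrace_spectral X t0; rewrite lecR.
move: s0; rewrite le_eqVlt => /orP[/eqP <-|s0].
  by rewrite mulr0 invr0 mulr0 oppr0 expR0 mulr1 (le_trans p1) // ler1n.
apply: subgaussian_tail => // k; apply: le_trans (momp k) _.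
by rewrite ler_pdivrMr // mom.
Qed.

Variable T : 'M[C]_N.
Hypothesis hT : CAR R n T.
Let TV := CAR_span hT.
Let c := car_coef T.
Local Notation G := (opnorm (CAR_absgrad T) ^+ 2).

Lemma grad_decomp : exists L : 'M[C]_N, (rc G)%:M = L^t* * L +
  \sum_j (partialD q c j * (partialD q c j)^t* + (partialD q c j)^t* * partialD q c j).
Proof.
rewrite /CAR_absgrad; set A := \sum_j _.
have AE : A = \sum_j (partialD q c j * (partialD q c j)^t*
  + (partialD q c j)^t* * partialD q c j).
  by apply: eq_bigr => j _; rewrite /mxsqmod !ffunE CAR_DE trmxCK.
rewrite -AE; apply: opnorm_decomp; rewrite AE; apply: psd_sum => j; apply: psdD.
  by rewrite -{1}[partialD q c j]trmxCK; exact: psd_sqmod.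
exact: psd_sqmod.
Qed.

Let G_ge0 : 0 <= G. Proof. exact: sqr_ge0. Qed.

Lemma deviation_centered (t : R) : 0 < t ->
  ntrace (spectral_measure (mxabs (T - (ntrace T)%:M)) `[t, +oo[%classic) <=
    rc (2 * expR (- (4 * t ^+ 2 / (pi ^+ 2 * G)))).
Proof.
move=> t0; apply: le_trans (_ : _ <= rc (2 * expR (- (t ^+ 2 / (2 * G))))) _.
  apply: ntrace_subgaussian => // k _; rewrite centerE //.
  have [L LE] := grad_decomp.
  have sumE : \sum_j (partialD q (car_coef0 T) j * (partialD q (car_coef0 T) j)^t* +
      (partialD q (car_coef0 T) j)^t* * partialD q (car_coef0 T) j) =
    \sum_j (partialD q c j * (partialD q c j)^t* + (partialD q c j)^t* * partialD q c j).
    by apply: eq_bigr => j _; rewrite partialD_coef0.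
  rewrite -sumE in LE.
  have c0 : car_coef0 T finset.set0 = 0 by rewrite /car_coef0 eqxx.
  exact: (sqmoment_stein fm N_gt0 LE k G_ge0 c0).
rewrite lecR ler_pM2l // ler_expR lerN2.
exact: (exponent_compare (sqr_ge0 t) G_ge0 (pi_sqr_ge8 R)).
Qed.

Lemma Kconst_ge0 (alpha : R) : 0 <= Kconst alpha.
Proof.
rewrite /Kconst mulr_ge0 ?invr_ge0 //; apply: Rintegral_ge0 => x _; last exact: powR_ge0.
by rewrite mulr_ge0 ?powR_ge0 ?expR_ge0.
Qed.

Lemma deviation_Npow (alpha t : R) : 0 < t -> 0 < alpha ->
  ntrace (spectral_measure (mxabs (CAR_Npow alpha T)) `[t, +oo[%classic) <=
    rc (2 * expR (- (t ^+ 2 / (2 * Kconst alpha ^+ 2 * G)))).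
Proof.
move=> t0 a0; rewrite -mulrA; apply: ntrace_subgaussian => //.
  by rewrite mulr_ge0 // sqr_ge0.
(* Only a positive variance needs moment bounds, and it forces [K_alpha > 0]. *)
move=> k KG0; have K0 : 0 < Kconst alpha.
  rewrite lt_neqAle Kconst_ge0 andbT eq_sym; apply: contraTneq KG0 => ->.
  by rewrite expr0n mul0r ltxx.
have [L LE] := grad_decomp.
rewrite CAR_NpowE //.
apply: (sqmoment_transfer fm N_gt0 LE) => // z M M0 le_M.
have := fractional_transfer a0 K0 M0 le_M; apply: le_trans.
rewrite le_eqVlt; apply/orP; left; apply/eqP; apply: eq_bigr => A _.
rewrite /npow_weight; case: eqP => [->|_] //.
by rewrite cards0 powR0 // gt_eqF.
Qed.

Lemma grad0_centered : CAR_grad T = 0 -> T - (ntrace T)%:M = 0.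
Proof.
move=> /grad_eq0 c0; rewrite centerE //; apply: big1 => A _; rewrite /car_coef0.
by case: eqP => [_|/eqP A0]; rewrite ?c0 // scale0r.
Qed.

Lemma grad0_Npow (alpha : R) : CAR_grad T = 0 -> CAR_Npow alpha T = 0.
Proof.
move=> /grad_eq0 c0; rewrite CAR_NpowE //; apply: big1 => A _; rewrite /npow_weight.
case: eqP => [_|/eqP A0]; last by rewrite c0 // mulr0 scale0r.
by have -> : rc 0 = 0 by []; rewrite mul0r scale0r.
Qed.

End Deviation.

Local Open Scope classical_set_scope.
Local Open Scope complex_scope.

Theorem corollary6p7 (R : realType) (n : nat) (T : 'M[R[i]]_(2 ^ n)) (t : R)
    (hn : (0 < n)%N) (hT : CAR R n T) (ht : 0 < t) :
  ntrace (spectral_measure (mxabs (T - (ntrace T)%:M)) `[t, +oo[)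
    <= (if CAR_grad T == 0 then 0
        else 2 * expR (- (4 * t ^+ 2
                          / (pi ^+ 2 * opnorm (CAR_absgrad T) ^+ 2))))%:C
  /\
  (forall alpha : R, 0 < alpha -> alpha < 1 / 2 ->
     ntrace (spectral_measure (mxabs (CAR_Npow alpha T)) `[t, +oo[)
       <= (if CAR_grad T == 0 then 0
           else 2 * expR (- (t ^+ 2
                             / (2 * Kconst alpha ^+ 2
                                * opnorm (CAR_absgrad T) ^+ 2))))%:C).
Proof.
case: eqP => [T0|_]; split.
- by rewrite grad0_centered // ntrace_spectral0.
- by move=> alpha _ _; rewrite grad0_Npow // ntrace_spectral0.
- exact: deviation_centered.
- by move=> alpha alpha0 _; apply: deviation_Npow.
Qed.
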